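(* Let $n\ge 2$, let $\Omega\subseteq\mathbb{R}^n$ be a bounded open set with $|\partial\Omega|<+\infty$, let $x_0\in\Omega$, and let $\partial\Omega$ be a harmonic pseudosphere centered at $x_0$. If there exists a point $z\in T(\partial\Omega,x_0)$ such that $S_z(\partial\Omega,x_0)\leq1$, then $\partial\Omega$ is a Euclidean sphere centered at $x_0$. Precisely, $$\partial\Omega=\partial B(x_0,|x_0-z|).$$
   Context: Notation: $\sigma$ is the $(n-1)$-dimensional Hausdorff measure in $\mathbb{R}^n$, $|\partial\Omega|$ denotes the $(n-1)$-Hausdorff measure of the topological boundary, $\fint_{\partial\Omega}u\,d\sigma=\frac1{|\partial\Omega|}\int_{\partial\Omega}u\,d\sigma$, $\omega_n$ is the Lebesgue measure of the unit ball of $\mathbb{R}^n$, $B(x,\rho)$ is the open Euclidean ball. Harmonic pseudosphere: for $\Omega\subseteq\mathbb{R}^n$ bounded open with $|\partial\Omega|<+\infty$ and $x_0\in\Omega$, $\partial\Omega$ is called a harmonic pseudosphere centered at $x_0$ if $u(x_0)=\fint_{\partial\Omega}u\,d\sigma$ for every function $u$ harmonic in $\Omega$ and continuous up to $\partial\Omega$ (i.e. continuous on $\overline\Omega$). Touching set: $T(\partial\Omega,x_0):=\{z\in\partial\Omega: |x_0-z|=\mathrm{dist}(\partial\Omega,x_0)\}$. Spherical flatness index: let $\Omega$ be open with every compact subset of $\partial\Omega$ of finite $(n-1)$-Hausdorff measure, $x_0\in\Omega$, $z\in T(\partial\Omega,x_0)$, $r:=|z-x_0|$. Then $$S_z(\partial\Omega,x_0):=\frac{2}{n\omega_n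 r}\liminf_{R\searrow0}\left(\liminf_{\alpha\to z,\ \alpha\notin\overline\Omega}\int_{\partial\Omega\cap B(z,R)}\frac{\langle\alpha-x,\alpha-x_0\rangle}{|x-\alpha|^n}\,d\sigma(x)\right)\in[-\infty,+\infty],$$ where the inner $\liminf$ is $+\infty$ (the standard convention $\inf\emptyset=+\infty$) if no points $\alpha\notin\overline\Omega$ converge to $z$. *)

(* Defs.v *)
From HB Require Import structures.
From mathcomp Require Import all_boot all_order all_algebra.
From mathcomp Require Import all_classical all_reals all_analysis.

Set Implicit Arguments.
Unset Strict Implicit.
Unset Printing Implicit Defensive.

Import Order.TTheory GRing.Theory Num.Theory.
Import numFieldNormedType.Exports.

Local Open Scope classical_set_scope.
Local Open Scope ring_scope.

(** R^n is ['rV[R]_n]: its library topology is the Euclidean one, but its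
    library norm is the max norm, whence [enorm], [eball] below. *)

Section Euclidean.
Context {R : realType} {n : nat}.
Implicit Types (x y : 'rV[R]_n) (A : set 'rV[R]_n).

Definition dot x y : R := \sum_(i < n) x 0 i * y 0 i.

Definition enorm x : R := Num.sqrt (dot x x).

Definition eball x (r : R) : set 'rV[R]_n := [set y | enorm (y - x) < r].

Definition boundary A : set 'rV[R]_n := closure A `\` interior A.

Definition edist A x : R := inf [set enorm (x - y) | y in A].

(** The element [0] only serves to give the empty set diameter [0]. *)
Definition ediam A : \bar R :=
  ereal_sup (0%E |` [set (enorm (x - y))%:E | x in A & y in A]).

End Euclidean.

Section Lebesgue.
Context {R : realType} {n : nat}.

(** Lebesgue (outer) measure on R^n, from at most countable covers by boxes;
    the boxes used are those with index in [P]. *)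
Definition lebesgue_rV (A : set 'rV[R]_n) : \bar R :=
  ereal_inf [set v | exists (P : pred nat) (a b : nat -> 'rV[R]_n),
    [/\ forall k i, a k 0 i <= b k 0 i,
        A `<=` \bigcup_(k in [set k | P k])
                 [set x | forall i, a k 0 i <= x 0 i <= b k 0 i]
      & v = (\sum_(k <oo | P k) (\prod_(i < n) (b k 0 i - a k 0 i))%:E)%E]].

End Lebesgue.

Definition omega {R : realType} (n : nat) : R :=
  fine (lebesgue_rV (eball (0 : 'rV[R]_n) 1)).

Section Hausdorff.
Context {R : realType} {n : nat}.
Local Open Scope ereal_scope.

(** The normalisation makes the [n]-dimensional Hausdorff measure of R^n equal
    to Lebesgue measure. *)
Definition hausdorff_gauge (s : nat) (U : set 'rV[R]_n) : \bar R :=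
  if U == set0 then 0 else (omega s / 2 ^+ s)%R%:E * ediam U ^+ s.

Definition hausdorff_delta (s : nat) (delta : R) (A : set 'rV[R]_n) : \bar R :=
  ereal_inf [set \sum_(k <oo) hausdorff_gauge s (U k) |
    U in [set U : (set 'rV[R]_n)^nat |
      (forall k, ediam (U k) <= delta%:E) /\ A `<=` \bigcup_k U k]].

Definition hausdorff (s : nat) (A : set 'rV[R]_n) : \bar R :=
  ereal_sup [set hausdorff_delta s delta A | delta in [set d | (0 < d)%R]].

Lemma lebesgue_rV_ge0 m (A : set 'rV[R]_m) : 0 <= lebesgue_rV A.
Proof.
apply: le_ereal_inf_tmp => _ [P [a [b [ab _ ->]]]].
apply: nneseries_ge0 => k _ _; rewrite lee_fin.
by apply: prodr_ge0 => i _; rewrite subr_ge0.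
Qed.

Lemma ediam_ge0 (A : set 'rV[R]_n) : 0 <= ediam A.
Proof. by apply: ereal_sup_ubound; left. Qed.

Lemma ediam_le (A B : set 'rV[R]_n) : A `<=` B -> ediam A <= ediam B.
Proof.
move=> AB; apply: ereal_sup_le => _ [->|[x Ax [y Ay <-]]]; first by left.
by right; exists x; [exact: AB|exists y; [exact: AB|]].
Qed.

Lemma ediam0 : ediam (@set0 'rV[R]_n) = 0.
Proof.
apply/eqP; rewrite eq_le ediam_ge0 andbT.
by apply: ge_ereal_sup => _ [->|[x []]].
Qed.

Lemma hausdorff_gauge0 s : hausdorff_gauge s set0 = 0.
Proof. by rewrite /hausdorff_gauge eqxx. Qed.

Lemma hausdorff_gauge_ge0 s U : 0 <= hausdorff_gauge s U.
Proof.
rewrite /hausdorff_gauge; case: ifP => // _; apply: mule_ge0.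
  by rewrite lee_fin divr_ge0 ?exprn_ge0// fine_ge0// lebesgue_rV_ge0.
by apply: expe_ge0; exact: ediam_ge0.
Qed.

(** The sets of diameter at most [delta] form a semiring of sets, for which
    [hausdorff_delta] is the library's outer measure extension [mu_ext]. *)
Definition small_sets (delta : {nonneg R}) : Type := 'rV[R]_n.

Section small_sets.
Variable delta : {nonneg R}.
Let small : set (set (small_sets delta)) :=
  [set U | ediam (U : set 'rV[R]_n) <= delta%:num%:E].

Let small0 : small set0.
Proof. by rewrite /small/= ediam0 lee_fin. Qed.

Let smallI : setI_closed small.
Proof. by move=> A B sA _; apply: le_trans sA; exact: ediam_le. Qed.

Let smallD : semi_setD_closed small.
Proof.
move=> A B sA _; exists [set A `\` B]; split.
- exact: finite_set1.
- by move=> _ ->; apply: le_trans sA; apply: ediam_le => x [].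
- by rewrite bigcup_set1.
- by move=> _ _ -> ->.
Qed.

HB.instance Definition _ := Pointed.on (small_sets delta).
HB.instance Definition _ := @isSemiRingOfSets.Build default_measure_display
  (small_sets delta) small small0 smallI smallD.

End small_sets.

Section outer.
Variable s : nat.

Lemma hausdorff_deltaE (delta : {nonneg R}) (A : set 'rV[R]_n) :
  hausdorff_delta s delta%:num A =
  mu_ext (hausdorff_gauge s : set (small_sets delta) -> \bar R) A.
Proof. by []. Qed.

Lemma hausdorff_delta_le (delta : {nonneg R}) (A : set 'rV[R]_n) :
  (0 < delta%:num)%R -> hausdorff_delta s delta%:num A <= hausdorff s A.
Proof. by move=> d0; apply: ereal_sup_ubound; exists delta%:num. Qed.

Let hausdorff0 : hausdorff s set0 = 0.
Proof.
apply/eqP; rewrite eq_le; apply/andP; split.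
  apply: ge_ereal_sup => _ [d /= /ltW d0 <-].
  rewrite (hausdorff_deltaE (NngNum d0)) mu_ext0//.
    exact: hausdorff_gauge0.
  exact: hausdorff_gauge_ge0.
have d1 : (0 < (1%:nng : {nonneg R})%:num)%R by [].
apply: (le_trans _ (hausdorff_delta_le set0 d1)).
by rewrite hausdorff_deltaE; apply: mu_ext_ge0; exact: hausdorff_gauge_ge0.
Qed.

Let hausdorff_ge0 A : 0 <= hausdorff s A.
Proof.
have d1 : (0 < (1%:nng : {nonneg R})%:num)%R by [].
apply: (le_trans _ (hausdorff_delta_le A d1)).
by rewrite hausdorff_deltaE; apply: mu_ext_ge0; exact: hausdorff_gauge_ge0.
Qed.

Let le_hausdorff : {homo hausdorff s : A B / A `<=` B >-> A <= B}.
Proof.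
move=> A B AB; apply: ge_ereal_sup => _ [d /= d0 <-].
have d0' : (0 < (NngNum (ltW d0))%:num)%R by [].
apply: (le_trans _ (hausdorff_delta_le B d0')).
exact: (@le_mu_ext _ (small_sets (NngNum (ltW d0))) R (hausdorff_gauge s) A B AB).
Qed.

Let hausdorff_sigma_subadditive : sigma_subadditive (hausdorff s).
Proof.
move=> F; apply: ge_ereal_sup => _ [d /= d0 <-].
rewrite (hausdorff_deltaE (NngNum (ltW d0))).
apply: (@le_trans _ _ (\sum_(i <oo)
    mu_ext (hausdorff_gauge s : set (small_sets (NngNum (ltW d0))) -> \bar R)
      (F i))).
  by apply: mu_ext_sigma_subadditive; exact: hausdorff_gauge_ge0.
apply: lee_nneseries => i _.
  by move=> _; apply: mu_ext_ge0; exact: hausdorff_gauge_ge0.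
exact: (hausdorff_delta_le (delta := NngNum (ltW d0))).
Qed.

HB.instance Definition _ := isOuterMeasure.Build R 'rV[R]_n (hausdorff s)
  hausdorff0 hausdorff_ge0 le_hausdorff hausdorff_sigma_subadditive.

End outer.

End Hausdorff.

(** [(n-1)]-dimensional Hausdorff measure on R^n, as a measure on its
    Caratheodory-measurable sets; its values on arbitrary sets are those of
    the outer measure. *)
Definition sigma {R : realType} {n : nat} :
    {measure set (caratheodory_type (@hausdorff R n n.-1)) -> \bar R} :=
  let mu : {outer_measure set 'rV[R]_n -> \bar R} := @hausdorff R n n.-1 in
  (mu : set (caratheodory_type mu) -> \bar R).

Section Harmonic.
Context {R : realType} {n : nat}.
Implicit Types (u : 'rV[R]_n -> R) (Omega : set 'rV[R]_n).

Definition partial u (i : 'I_n) : 'rV[R]_n -> R :=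
  fun x => derive u x (delta_mx 0 i).

Definition C2_on Omega u : Prop := forall x, Omega x ->
  {for x, continuous u} /\
  forall i, derivable u x (delta_mx 0 i) /\ {for x, continuous (partial u i)} /\
  forall j, derivable (partial u i) x (delta_mx 0 j) /\
            {for x, continuous (partial (partial u i) j)}.

Definition laplacian u : 'rV[R]_n -> R :=
  fun x => \sum_(i < n) partial (partial u i) i x.

(** Here [Omega] is meant to be open, so that values of [u] outside of [Omega]
    are irrelevant. *)
Definition harmonic_on Omega u : Prop :=
  C2_on Omega u /\ forall x, Omega x -> laplacian u x = 0.

Definition boundary_mean Omega u : R :=
  (fine (sigma (boundary Omega)))^-1 * \int[sigma]_(x in boundary Omega) u x.

Definition harmonic_pseudosphere Omega (x0 : 'rV[R]_n) : Prop :=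
  forall u, harmonic_on Omega u -> {within closure Omega, continuous u} ->
    u x0 = boundary_mean Omega u.

End Harmonic.

Section Flatness.
Context {R : realType} {n : nat}.
Implicit Types (Omega : set 'rV[R]_n) (z : 'rV[R]_n).

Definition touching_set Omega (x0 : 'rV[R]_n) : set 'rV[R]_n :=
  [set z | boundary Omega z /\ enorm (x0 - z) = edist (boundary Omega) x0].

Definition flatness_integral Omega (x0 : 'rV[R]_n) z (rho : R)
    (alpha : 'rV[R]_n) : \bar R :=
  (\int[sigma]_(x in boundary Omega `&` eball z rho)
     (dot (alpha - x) (alpha - x0) / enorm (x - alpha) ^+ n)%:E)%E.

(** When no point outside of [closure Omega] converges to [z], the inner filter
    contains [set0], and the inner liminf is the infimum of the empty set. *)
Definition spherical_flatness Omega (x0 : 'rV[R]_n) z : \bar R :=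
  ((2 / (n%:R * omega n * enorm (z - x0)))%:E *
   limf_einf (fun rho : R =>
     limf_einf (flatness_integral Omega x0 z rho) (within (~` closure Omega) (nbhs z)))
     0^'+)%E.

End Flatness.

(* Main.v *)
Require Import Defs.
From HB Require Import structures.
From mathcomp Require Import all_boot all_order all_algebra.
From mathcomp Require Import all_classical all_reals all_analysis.
From mathcomp Require Import measurable_realfun zify ring lra.

(** Write [r = |z - x0|], [K] for the boundary of [Omega] and [|K|] for its area. For a
    pole [a] outside the closure of [Omega], the Poisson kernel
    [p x = (|a - x0| ^ 2 - |x - x0| ^ 2) / |x - a| ^ n] is harmonic in [Omega] and
    continuous up to the boundary, and it takes the value [|a - x0| ^ (2 - n)] at [x0].
    Twice the integrand of the flatness index is [|x - a| ^ (2 - n) + p x], so near [z]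
    the kernel is dominated by it. As [a] tends to [z], the mean value property of [p]
    and the hypothesis on the flatness index give ([pseudosphere_bound])
    [|K| / r ^ (n - 2) + kap * sigma far <= n * omega n * r],
    where [far] is the part of [K] at distance at least [r + delta] from [x0], and
    [kap > 0]: away from [z] the limit of [p] is nonpositive on [K], since [K] lies
    outside the ball of radius [r], and it is negative on [far].

    On the other hand every ray from [x0] meets [K], so that the radial retraction maps
    [K] onto the sphere of radius [r]. As this retraction is contracting, [|K|] is at
    least the area [n * omega n * r ^ (n - 1)] of the sphere ([hausdorff_ge_sphere]), so
    [sigma far = 0] for all [delta]. If [Omega] had a point outside the closed ball, the
    rays through its neighbours would meet [K] in a set of positive area
    ([hausdorff_gt0]) contained in [far] for some [delta]. Thus [Omega] is the ball.

    Both area bounds compare Hausdorff measure with volume. The cone of height [h] over a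
    piece of [K] of small diameter [d] is, after a rotation, contained in a cylinder of
    height [h + d], the projection of which has diameter about [d]; by the isodiametric
    inequality in dimension [n - 1], the volume of the cone is at most about [h] times
    the term of the piece in the definition of Hausdorff measure. Hence the volume of a
    cone over a set is at most about [h] times its area ([lebesgue_cone_hausdorff]).
    The isodiametric inequality is derived from the Brunn--Minkowski inequality for
    unions of grid cells ([card_sumset_cube]), that is, from a discrete form of the
    Prekopa--Leindler inequality. The volume is an outer measure given by covers by
    boxes: its lower bounds come from iterated integration of indicator functions
    ([prod_co_le_series]), and its behaviour under rotations from their decomposition
    into shears ([rotate_to_axis]). Finally, integrals over [K] can be split because
    closed sets are measurable for Hausdorff measure ([closed_caratheodory]). *)

Set Implicit Arguments.
Unset Strict Implicit.
Unset Printing Implicit Defensive.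

Import Order.TTheory GRing.Theory Num.Theory.
Import numFieldNormedType.Exports.

Local Open Scope classical_set_scope.
Local Open Scope ring_scope.

(** * The Euclidean norm *)

Section EuclideanNorm.
Context {R : realType} {n : nat}.
Implicit Types (x y z : 'rV[R]_n) (a b : R).

Lemma dotC x y : dot x y = dot y x.
Proof. by apply: eq_bigr => i _; rewrite mulrC. Qed.

Lemma dotDl x y z : dot (x + y) z = dot x z + dot y z.
Proof. by rewrite -big_split; apply: eq_bigr => i _; rewrite mxE mulrDl. Qed.

Lemma dotZl a x y : dot (a *: x) y = a * dot x y.
Proof. by rewrite mulr_sumr; apply: eq_bigr => i _; rewrite mxE mulrA. Qed.

Lemma dotNl x y : dot (- x) y = - dot x y.
Proof. by rewrite -scaleN1r dotZl mulN1r. Qed.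

Lemma dotDr x y z : dot x (y + z) = dot x y + dot x z.
Proof. by rewrite dotC dotDl !(dotC x). Qed.

Lemma dotZr a x y : dot x (a *: y) = a * dot x y.
Proof. by rewrite dotC dotZl dotC. Qed.

Lemma dotNr x y : dot x (- y) = - dot x y.
Proof. by rewrite dotC dotNl dotC. Qed.

Definition dotE := (dotDl, dotDr, dotNl, dotNr, dotZl, dotZr).

Lemma dot_ge0 x : 0 <= dot x x.
Proof. by apply: sumr_ge0 => i _; rewrite -expr2 sqr_ge0. Qed.

Lemma dot_eq0 x : dot x x = 0 -> x = 0.
Proof.
move=> /eqP; rewrite psumr_eq0; last by move=> i _; rewrite -expr2 sqr_ge0.
move=> /allP x0; apply/rowP => i; rewrite mxE.
by have := x0 i (mem_index_enum i); rewrite mulf_eq0 orbb => /eqP.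
Qed.

Lemma enorm_ge0 x : 0 <= enorm x. Proof. exact: sqrtr_ge0. Qed.

Lemma sqr_enorm x : enorm x ^+ 2 = dot x x.
Proof. by rewrite sqr_sqrtr ?dot_ge0. Qed.

Lemma enorm0 : enorm (0 : 'rV[R]_n) = 0.
Proof. by rewrite /enorm -(scale0r 0) dotZl mul0r sqrtr0. Qed.

Lemma enorm_eq0 x : enorm x = 0 -> x = 0.
Proof. by move=> x0; apply: dot_eq0; rewrite -sqr_enorm x0 expr0n. Qed.

Lemma enorm_gt0 x : x != 0 -> 0 < enorm x.
Proof.
move=> x0; rewrite lt_neqAle enorm_ge0 andbT eq_sym.
by apply: contra_neq x0; exact: enorm_eq0.
Qed.

Lemma enormZ a x : enorm (a *: x) = `|a| * enorm x.
Proof. by rewrite /enorm dotZl dotZr mulrA -expr2 sqrtrM ?sqr_ge0// sqrtr_sqr. Qed.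

Lemma enormN x : enorm (- x) = enorm x.
Proof. by rewrite -scaleN1r enormZ normrN1 mul1r. Qed.

Lemma enormB x y : enorm (x - y) = enorm (y - x).
Proof. by rewrite -enormN opprB. Qed.

Lemma cauchy_schwarz x y : dot x y <= enorm x * enorm y.
Proof.
apply: (le_trans (ler_norm _)).
rewrite -(@ler_pXn2r _ 2)// ?nnegrE ?mulr_ge0 ?enorm_ge0//.
rewrite real_normK ?num_real// exprMn !sqr_enorm.
have [y0|y0] := eqVneq (dot y y) 0.
  by rewrite (dot_eq0 y0) -(scale0r 0) !dotZr !mul0r expr0n mulr0.
have yp : 0 < dot y y by rewrite lt_neqAle eq_sym y0 dot_ge0.
have := dot_ge0 (dot y y *: x - dot x y *: y).
rewrite !dotE (dotC y x) => H.
rewrite -subr_ge0 -(pmulr_rge0 _ yp) [X in 0 <= X](_ : _ = dot y y *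
  (dot y y * dot x x - dot x y * dot x y)); last by ring.
by move: H; rewrite [X in _ <= X -> _](_ : _ = dot y y *
  (dot y y * dot x x - dot x y * dot x y)); last by ring.
Qed.

Lemma enormD x y : enorm (x + y) <= enorm x + enorm y.
Proof.
rewrite -(@ler_pXn2r _ 2)// ?nnegrE ?addr_ge0 ?enorm_ge0//.
rewrite sqr_enorm sqrrD !sqr_enorm !dotE (dotC y x).
have := cauchy_schwarz x y; lra.
Qed.

Lemma enorm_dist x y z : enorm (x - z) <= enorm (x - y) + enorm (y - z).
Proof.
have -> : x - z = (x - y) + (y - z) by rewrite addrA subrK.
exact: enormD.
Qed.

Lemma ler_enorm_coord x i : `|x 0 i| <= enorm x.
Proof.
rewrite -sqrtr_sqr; apply: ler_wsqrtr; rewrite /dot (bigD1 i)//= -expr2 lerDl.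
by apply: sumr_ge0 => j _; rewrite -expr2 sqr_ge0.
Qed.

Lemma enorm_ler_coord x a : (forall i, `|x 0 i| <= a) -> enorm x <= n%:R * a.
Proof.
move=> xa; case: (pickP (mem 'I_n)) => [i _|n0]; last first.
  have n_0 : n = 0%N.
    by apply/eqP; rewrite -leqn0 leqNgt; apply/negP => np; have := n0 (Ordinal np).
  have -> : x = 0 by apply/rowP => i; have := n0 i.
  by rewrite enorm0 n_0 mul0r.
have a0 : 0 <= a by apply: le_trans (xa i).
have n1 : 1 <= n%:R :> R by rewrite ler1n; case: n i {xa} => // -[].
have na : 0 <= n%:R * a by rewrite mulr_ge0.
rewrite -(ger0_norm na) -sqrtr_sqr; apply: ler_wsqrtr.
apply: (@le_trans _ _ (\sum_(j < n) a ^+ 2)).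
  by apply: ler_sum => j _; rewrite -expr2 -real_normK ?num_real// lerXn2r.
rewrite sumr_const card_ord -[a ^+ 2 *+ n]mulr_natl exprMn.
apply: ler_wpM2r; first exact: sqr_ge0.
by rewrite expr2 ler_peMl// ler0n.
Qed.

End EuclideanNorm.

(** * Lebesgue outer measure *)

Lemma esum_Zl_le (R : realType) (T : choiceType) (I : set T) (c : R) (a : T -> \bar R) :
  0 <= c -> (forall t, (0 <= a t)%E) ->
  (\esum_(t in I) (c%:E * a t) <= c%:E * \esum_(t in I) a t)%E.
Proof.
move=> c0 a0; apply: ge_ereal_sup => _ [X [finX XI]] <-.
rewrite -ge0_mule_fsumr//; apply: lee_wpmul2l; rewrite ?lee_fin//.
by apply: ereal_sup_ubound; exists X.
Qed.

Section LebesgueOuter.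
Context {R : realType} {n : nat}.
Implicit Types (A B : set 'rV[R]_n) (a b : 'rV[R]_n).

Definition box a b : set 'rV[R]_n := [set x | forall i, a 0 i <= x 0 i <= b 0 i].

Definition vol a b : R := \prod_(i < n) (b 0 i - a 0 i).

Lemma vol_ge0 a b : (forall i, a 0 i <= b 0 i) -> 0 <= vol a b.
Proof. by move=> ab; apply: prodr_ge0 => i _; rewrite subr_ge0. Qed.

(** Covers indexed by any countable type are allowed, so that covers can be
    combined without numbering them. *)
Lemma lebesgue_le_esum (T : countType) (I : set T) (a b : T -> 'rV[R]_n) A :
  (forall t, I t -> forall i, a t 0 i <= b t 0 i) ->
  A `<=` \bigcup_(t in I) box (a t) (b t) ->
  (lebesgue_rV A <= \esum_(t in I) (vol (a t) (b t))%:E)%E.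
Proof.
move=> ab AI.
pose f (c : T -> 'rV[R]_n) k := if unpickle k is Some t then
  if t \in I then c t else 0 else 0.
pose P : pred nat := fun k => `[< exists2 t, I t & pickle t = k >].
have fE c t : I t -> f c (pickle t) = c t.
  by move=> It; rewrite /f pickleK mem_set.
apply: ereal_inf_lbound; exists P, (f a), (f b); split.
- move=> k i; rewrite /f; case: unpickle => // t; case: ifPn => // /set_mem It.
  exact: ab.
- move=> x /AI[t It xt]; exists (pickle t); first by apply/asboolP; exists t.
  by move=> i; rewrite !fE.
- rewrite nneseries_esum; last first.
    move=> k /asboolP[t It <-]; rewrite lee_fin; apply: prodr_ge0 => i _.
    by rewrite !fE// subr_ge0 ab.
  have -> : [set x | P x] = pickle @` I.
    by apply/seteqP; split=> k /=; [move=> /asboolP|move=> ?; apply/asboolP].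
  rewrite esum_image; last by move=> x y _ _; exact: (pcan_inj pickleK).
  by apply: eq_esum => t It; rewrite !fE.
Qed.

Lemma lebesgue_cover A (e : R) : (lebesgue_rV A < +oo)%E -> 0 < e ->
  exists (I : set nat) (a b : nat -> 'rV[R]_n),
    [/\ forall k i, a k 0 i <= b k 0 i, A `<=` \bigcup_(k in I) box (a k) (b k)
      & (\esum_(k in I) (vol (a k) (b k))%:E <= lebesgue_rV A + e%:E)%E].
Proof.
move=> Aoo e0; have Afin : lebesgue_rV A \is a fin_num.
  by rewrite ge0_fin_numE// lebesgue_rV_ge0.
have [_ [P [a [b [ab AP ->]]]] /ltW le] := lb_ereal_inf_adherent e0 Afin.
exists [set k | P k], a, b; split=> //.
rewrite nneseries_esum// in le => k _.
by rewrite lee_fin vol_ge0.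
Qed.

Lemma lebesgue_le A B : A `<=` B -> (lebesgue_rV A <= lebesgue_rV B)%E.
Proof.
move=> AB; apply: ereal_inf_le_tmp => _ [P [a [b [ab BP ->]]]].
by exists P, a, b; split=> //; apply: subset_trans BP.
Qed.

Lemma lebesgue_bigcup (F : nat -> set 'rV[R]_n) :
  (lebesgue_rV (\bigcup_k F k) <= \sum_(k <oo) lebesgue_rV (F k))%E.
Proof.
have [[k koo]|/forallNP Foo] := pselect (exists k, lebesgue_rV (F k) = +oo%E).
  rewrite (eseries_pinfty _ _ koo) ?leey// => i _.
  by rewrite -ltNye (lt_le_trans _ (lebesgue_rV_ge0 _)).
apply/lee_addgt0Pr => e e0.
rewrite (le_trans _ (epsilon_trick _ _ (ltW e0)))//; last first.
  by move=> k; exact: lebesgue_rV_ge0.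
have e2 k : 0 < e / (2 ^ k.+1)%:R by rewrite divr_gt0// ltr0n expn_gt0.
pose p k (G : set nat * (nat -> 'rV[R]_n) * (nat -> 'rV[R]_n)) :=
  [/\ forall j i, G.1.2 j 0 i <= G.2 j 0 i,
      F k `<=` \bigcup_(j in G.1.1) box (G.1.2 j) (G.2 j)
    & (\esum_(j in G.1.1) (vol (G.1.2 j) (G.2 j))%:E <=
         lebesgue_rV (F k) + (e / (2 ^ k.+1)%:R)%:E)%E].
have [G pG] : {G & forall k, p k (G k)}.
  apply: (@choice _ _ p) => k.
  have [|I [a [b [ab FI le]]]] := lebesgue_cover (A := F k) _ (e2 k).
    by rewrite ltey; apply/eqP; exact: Foo.
  by exists (I, a, b).
apply: (@le_trans _ _ (\esum_(t in [set: nat] `*`` (fun k => (G k).1.1))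
    (vol ((G t.1).1.2 t.2) ((G t.1).2 t.2))%:E)).
  apply: lebesgue_le_esum => [[k j] _ i|]; first by have [] := pG k.
  move=> x [k _ Fx]; have [_ /(_ _ Fx)[j Gj xj] _] := pG k.
  by exists (k, j).
rewrite -(@esum_esum _ _ _ setT (fun k => (G k).1.1) (fun k j =>
  (vol ((G k).1.2 j) ((G k).2 j))%:E)); last first.
  by move=> k j _ _; rewrite lee_fin vol_ge0//; have [] := pG k.
have vG k : (0 <= \esum_(j in (G k).1.1) (vol ((G k).1.2 j) ((G k).2 j))%:E)%E.
  by apply: esum_ge0 => j _; rewrite lee_fin vol_ge0//; have [] := pG k.
rewrite -nneseries_esumT//.
by apply: lee_nneseries => [k _ _|k _]; [exact: vG|have [] := pG k].
Qed.

Lemma lebesgue0 : lebesgue_rV (@set0 'rV[R]_n) = 0%E.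
Proof.
apply/eqP; rewrite eq_le lebesgue_rV_ge0 andbT.
apply: (@le_trans _ _ (\esum_(t in @set0 nat) (vol (0 : 'rV[R]_n) 0)%:E)).
  exact: (@lebesgue_le_esum _ _ (fun=> 0) (fun=> 0)).
by rewrite esum_set0.
Qed.

Lemma lebesgueU A B :
  (lebesgue_rV (A `|` B) <= lebesgue_rV A + lebesgue_rV B)%E.
Proof.
rewrite -bigcup2E; apply: le_trans (lebesgue_bigcup _) _.
rewrite (nneseries_split 0 2); last by move=> k _; exact: lebesgue_rV_ge0.
rewrite add0n big_mkord !big_ord_recl big_ord0 /= adde0 eseries0 ?adde0//.
by move=> [|[|k]]//= _ _; exact: lebesgue0.
Qed.

Lemma lebesgue_box a b : (forall i, a 0 i <= b 0 i) ->
  (lebesgue_rV (box a b) <= (vol a b)%:E)%E.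
Proof.
move=> ab; rewrite -(@esum_set1 _ _ tt (fun=> (vol a b)%:E)); last first.
  by rewrite lee_fin vol_ge0.
apply: (@lebesgue_le_esum _ _ (fun=> a) (fun=> b)) => //.
by move=> x xab; exists tt.
Qed.

(** The reverse inequality follows from this one for the inverse dilation. *)
Lemma lebesgue_scale_le (t : R) A : 0 < t ->
  (lebesgue_rV [set t *: x | x in A] <= (t ^+ n)%:E * lebesgue_rV A)%E.
Proof.
move=> t0; have tn0 : 0 < t ^+ n by rewrite exprn_gt0.
have [->|Aoo] := eqVneq (lebesgue_rV A) +oo%E.
  by rewrite gt0_muley ?lte_fin ?leey.
have {}Aoo : (lebesgue_rV A < +oo)%E by rewrite ltey.
apply/lee_addgt0Pr => e e0.
have [I [a [b [ab AI le]]]] := lebesgue_cover Aoo (divr_gt0 e0 tn0).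
have -> : e%:E = ((t ^+ n)%:E * (e / t ^+ n)%:E)%E.
  by rewrite -EFinM mulrCA divff ?mulr1// gt_eqF.
rewrite -muleDr ?ge0_adde_def ?inE ?lebesgue_rV_ge0 ?lee_fin ?divr_ge0
  ?(ltW e0) ?(ltW tn0)//.
apply: le_trans (lee_wpmul2l _ le); last by rewrite lee_fin ltW.
apply: (@le_trans _ _ (\esum_(k in I) (vol (t *: a k) (t *: b k))%:E)).
  apply: lebesgue_le_esum => [k _ i|_ [x /AI[k Ik xk] <-]].
    by rewrite !mxE ler_pM2l.
  by exists k => // i; rewrite !mxE !ler_pM2l.
apply: le_trans (esum_Zl_le _ _ _); last 2 first.
- exact: ltW.
- by move=> k; rewrite lee_fin vol_ge0.
apply: le_esum => k _; rewrite -EFinM lee_fin.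
rewrite /vol (eq_bigr (fun i => t * (b k 0 i - a k 0 i))); last first.
  by move=> i _; rewrite !mxE mulrBr.
by rewrite big_split/= prodr_const card_ord.
Qed.

End LebesgueOuter.

(** * Monotonicity of the volume of boxes *)

Section BoxComparison.
Context {R : realType}.
Local Notation leb := (@lebesgue_measure R).

Lemma integral_co (d p q : R) : 0 <= d -> p <= q ->
  (\int[leb]_t (d * \1_(`[p, q[%classic) t)%:E = (d * (q - p))%:E)%E.
Proof.
move=> d0 pq; under eq_integral do rewrite EFinM.
rewrite ge0_integralZl_EFin//=; last by apply/measurable_EFinP; exact: measurable_indic.
rewrite integral_indic// setIT.
rewrite EFinM; congr (_ * _)%E; apply: (etrans (lebesgue_measure_itv _)).
rewrite /= lte_fin; case: ltP => [_|qp]; first by rewrite EFinB.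
by rewrite (@le_anti _ _ p q) ?pq ?subrr.
Qed.

Lemma integral_cc (d p q : R) : 0 <= d -> p <= q ->
  (\int[leb]_t (d * \1_(`[p, q]%classic) t)%:E = (d * (q - p))%:E)%E.
Proof.
move=> d0 pq; under eq_integral do rewrite EFinM.
rewrite ge0_integralZl_EFin//=; last by apply/measurable_EFinP; exact: measurable_indic.
rewrite integral_indic// setIT.
rewrite EFinM; congr (_ * _)%E; apply: (etrans (lebesgue_measure_itv _)).
rewrite /= lte_fin; case: ltP => [_|qp]; first by rewrite EFinB.
by rewrite (@le_anti _ _ p q) ?pq ?subrr.
Qed.

Lemma measurable_step (d : R) (A : set R) : measurable A ->
  measurable_fun setT (fun t => (d * \1_A t)%:E).
Proof.
by move=> mA; apply/measurable_EFinP; apply: measurable_funM.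
Qed.

Lemma integral_sum_co (J : finType) (d p q : J -> R) :
  (forall j, 0 <= d j) -> (forall j, p j <= q j) ->
  (\int[leb]_t (\sum_j d j * \1_(`[p j, q j[%classic) t)%:E =
   (\sum_j d j * (q j - p j))%:E)%E.
Proof.
move=> d0 pq; under eq_integral do rewrite -sumEFin.
rewrite ge0_integral_sum//.
- by rewrite -sumEFin; apply: eq_bigr => j _; exact: integral_co.
- by move=> j; exact: measurable_step.
- by move=> j t _; rewrite lee_fin mulr_ge0.
Qed.

Lemma measurable_sum_co (J : finType) (d p q : J -> R) :
  measurable_fun setT (fun t => (\sum_j d j * \1_(`[p j, q j[%classic) t)%:E).
Proof.
under eq_fun do rewrite -sumEFin.
by apply: emeasurable_sum => j _; exact: measurable_step.
Qed.

Lemma sum_co_le (J K : finType) (d p q : J -> R) (c a b : K -> R) :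
  (forall j, 0 <= d j) -> (forall j, p j <= q j) ->
  (forall k, 0 <= c k) -> (forall k, a k <= b k) ->
  (forall t, \sum_j d j * \1_(`[p j, q j[%classic) t <=
             \sum_k c k * \1_(`[a k, b k[%classic) t) ->
  \sum_j d j * (q j - p j) <= \sum_k c k * (b k - a k).
Proof.
move=> d0 pq c0 ab le; rewrite -lee_fin -!integral_sum_co//.
by apply: ge0_le_integral => //; do ?[exact: measurable_sum_co];
  move=> t _; rewrite lee_fin//; apply: sumr_ge0 => j _; rewrite mulr_ge0.
Qed.

Lemma sum_co_le_series (J : finType) (d p q : J -> R) (c a b : nat -> R) :
  (forall j, 0 <= d j) -> (forall j, p j <= q j) ->
  (forall k, 0 <= c k) -> (forall k, a k <= b k) ->
  (forall t, ((\sum_j d j * \1_(`[p j, q j[%classic) t)%:E <=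
             \sum_(k <oo) (c k * \1_(`[a k, b k]%classic) t)%:E)%E) ->
  ((\sum_j d j * (q j - p j))%:E <= \sum_(k <oo) (c k * (b k - a k))%:E)%E.
Proof.
move=> d0 pq c0 ab le; rewrite -integral_sum_co//.
under eq_eseriesr do rewrite -integral_cc//.
rewrite -integral_nneseries//; last first.
- by move=> k t _; rewrite lee_fin mulr_ge0.
- by move=> k; exact: measurable_step.
apply: ge0_le_integral => //.
- by move=> t _; rewrite lee_fin sumr_ge0// => j _; rewrite mulr_ge0.
- exact: measurable_sum_co.
- apply: ge0_emeasurable_sum => [k t _ _|k _]; first by rewrite lee_fin mulr_ge0.
  exact: measurable_step.
Qed.

(** Volume is monotone because it is an iterated integral: integrating the
    pointwise inequality over one coordinate at a time turns the weights of the
    slices into weighted volumes. The weights are there for this induction. *)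
Lemma prod_co_le_series (m : nat) (J : finType) (d : J -> R)
    (p q : J -> 'I_m -> R) (c : nat -> R) (a b : nat -> 'I_m -> R) :
  (forall j, 0 <= d j) -> (forall j i, p j i <= q j i) ->
  (forall k, 0 <= c k) -> (forall k i, a k i <= b k i) ->
  (forall x : 'I_m -> R,
    ((\sum_j d j * \prod_i \1_(`[p j i, q j i[%classic) (x i))%:E <=
     \sum_(k <oo) (c k * \prod_i \1_(`[a k i, b k i]%classic) (x i))%:E)%E) ->
  ((\sum_j d j * \prod_i (q j i - p j i))%:E <=
   \sum_(k <oo) (c k * \prod_i (b k i - a k i))%:E)%E.
Proof.
elim: m J d p q c a b => [|m IH] J d p q c a b d0 pq c0 ab le.
  have := le (fun=> 0).
  under eq_bigr do rewrite big_ord0.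
  under eq_eseriesr do rewrite big_ord0.
  by under [in X in _ -> X]eq_bigr do rewrite big_ord0;
    under [in X in _ -> X]eq_eseriesr do rewrite big_ord0.
pose l := lift (@ord0 m).
have vq j : 0 <= \prod_(i < m) (q j (l i) - p j (l i)).
  by apply: prodr_ge0 => i _; rewrite subr_ge0.
have vb k : 0 <= \prod_(i < m) (b k (l i) - a k (l i)).
  by apply: prodr_ge0 => i _; rewrite subr_ge0.
have split_vol (e : R) (f : 'I_m.+1 -> R) :
    e * \prod_i f i = e * \prod_(i < m) f (l i) * f ord0.
  by rewrite big_ord_recl mulrA mulrAC.
under eq_bigr do rewrite split_vol//.
under eq_eseriesr do rewrite split_vol//.
apply: sum_co_le_series => // [j|k|t]; [exact: mulr_ge0|exact: mulr_ge0|].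
under eq_bigr do rewrite mulrAC.
under eq_eseriesr do rewrite mulrAC.
apply: (IH J (fun j => d j * \1_(`[p j ord0, q j ord0[%classic) t)
  (fun j i => p j (l i)) (fun j i => q j (l i))
  (fun k => c k * \1_(`[a k ord0, b k ord0]%classic) t)
  (fun k i => a k (l i)) (fun k i => b k (l i))) => // [j|k|y].
- by rewrite mulr_ge0.
- by rewrite mulr_ge0.
have := le (fun i => if unlift ord0 i is Some i' then y i' else t).
under eq_bigr do rewrite big_ord_recl unlift_none mulrA.
under eq_eseriesr do rewrite big_ord_recl unlift_none mulrA.
under eq_bigr do under eq_bigr do rewrite liftK.
by under eq_eseriesr do under eq_bigr do rewrite liftK.
Qed.

End BoxComparison.

Section LebesgueLower.
Context {R : realType} {n : nat}.
Implicit Types (A : set 'rV[R]_n).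

Lemma prod_indic_co (a b x : 'I_n -> R) :
  \prod_i \1_(`[a i, b i[%classic) (x i) = (`[< forall i, a i <= x i < b i >])%:R :> R.
Proof.
case: asboolP => [h|/existsNP[i h]].
  by apply: big1 => i _; rewrite indicE mem_set//= in_itv/= h.
by rewrite (bigD1 i)//= indicE memNset ?mul0r//= in_itv.
Qed.

Lemma prod_indic_cc (a b x : 'I_n -> R) :
  \prod_i \1_(`[a i, b i]%classic) (x i) = (`[< forall i, a i <= x i <= b i >])%:R :> R.
Proof.
case: asboolP => [h|/existsNP[i h]].
  by apply: big1 => i _; rewrite indicE mem_set//= in_itv/= h.
by rewrite (bigD1 i)//= indicE memNset ?mul0r//= in_itv.
Qed.

(** The cells are half-open so that disjoint ones can tile a set; the sum of their
    indicator functions is then dominated by that of any cover by closed boxes. *)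
Lemma lebesgue_ge_cells (J : finType) (p q : J -> 'rV[R]_n) A :
  (forall j i, p j 0 i <= q j 0 i) ->
  (forall (x : 'I_n -> R) j k, (forall i, p j 0 i <= x i < q j 0 i) ->
                 (forall i, p k 0 i <= x i < q k 0 i) -> j = k) ->
  (forall j (x : 'rV[R]_n), (forall i, p j 0 i <= x 0 i < q j 0 i) -> A x) ->
  ((\sum_j vol (p j) (q j))%:E <= lebesgue_rV A)%E.
Proof.
move=> pq disj pqA; apply: le_ereal_inf_tmp => _ [P [a [b [ab AP ->]]]].
have -> : \sum_j vol (p j) (q j) = \sum_j 1 * \prod_i (q j 0 i - p j 0 i).
  by apply: eq_bigr => j _; rewrite mul1r.
apply: (@le_trans _ _ (\sum_(k <oo) ((P k)%:R * vol (a k) (b k))%:E)%E); last first.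
  rewrite [leRHS]eseries_mkcond; apply: lee_nneseries => [k _ _|k _].
    by rewrite lee_fin mulr_ge0 ?vol_ge0.
  by case: (P k); rewrite ?mul1r ?mul0r.
apply: prod_co_le_series => //.
move=> x; under eq_bigr do rewrite mul1r prod_indic_co.
have t0 k : (0%:E <=
    ((P k)%:R * \prod_(i < n) \1_(`[a k 0 i, b k 0 i]%classic) (x i) : R)%:E)%E.
  by rewrite prod_indic_cc lee_fin mulr_ge0.
have [[j xj]|/forallNP nox] :=
  pselect (exists j, forall i, p j 0 i <= x i < q j 0 i); last first.
  rewrite big1 => [|j _]; first exact: nneseries_ge0.
  by rewrite asboolF// => h; apply: (nox j).
rewrite (bigD1 j)//= big1 ?addr0; last first.
  by move=> k kj; rewrite asboolF// => h; move/eqP: kj; apply; apply: disj xj.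
have [k Pk xk] : (\bigcup_(k in [set k | P k]) box (a k) (b k)) (\row_i x i).
  by apply/AP/(pqA j) => i; rewrite mxE.
rewrite (nneseriesD1 (n := k))//.
apply: (@le_trans _ _ _ _ _ _ (leeDl _ (nneseries_ge0 _))); last by [].
rewrite prod_indic_cc lee_fin mulr_natl asboolT// Pk asboolT//.
by move=> i; have := xk i; rewrite mxE.
Qed.

End LebesgueLower.

(** * Brunn--Minkowski on grids *)

Section DiscreteBrunnMinkowski.
Context {R : realType}.

(** The translate of [S] by the least element of [T] lies before the translate
    of [T] by one more than the greatest element of [S], so that [U] contains
    disjoint copies of [S] and [T]. *)
Lemma card_sumset1 N (S T : {set 'I_N}) (U : {set 'I_(N + N)}) :
  S != finset.set0 -> T != finset.set0 ->
  (forall (s t : 'I_N) (u : 'I_(N + N)), s \in S -> t \in T ->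
     (u == s + t :> nat)%N || (u == (s + t).+1 :> nat)%N -> u \in U) ->
  (#|S| + #|T| <= #|U|)%N.
Proof.
move=> /set0Pn[s0 s0S] /set0Pn[t0 t0T] STU.
case: (arg_maxnP (fun s : 'I_N => val s) s0S) => {s0S} s1 s1S s1max.
case: (arg_minnP (fun t : 'I_N => val t) t0T) => {t0T} t1 t1T t1min.
have lt1 (s : 'I_N) : (s + t1 < N + N)%N by rewrite -addnS leq_add// ltnW.
have lt2 (t : 'I_N) : ((s1 + t).+1 < N + N)%N by rewrite -addSn -addnS leq_add.
pose f s := Ordinal (lt1 s); pose g t := Ordinal (lt2 t).
have fI : injective f by move=> s s' [/addIn /val_inj].
have gI : injective g by move=> t t' [/addnI /val_inj].
rewrite -(card_imset (mem S) fI) -(card_imset (mem T) gI).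
rewrite -cardsUI.
have -> : (f @: S) :&: (g @: T) = finset.set0.
  apply/setP => u; rewrite !inE; apply/negP => /andP[/imsetP[s sS ->] /imsetP[t tT]].
  move=> /(congr1 val) /= E; have /= := s1max s sS; have /= := t1min t tT; move: E; lia.
rewrite cards0 addn0; apply: subset_leq_card; apply/fintype.subsetP => u.
rewrite inE => /orP[] /imsetP[i iS ->].
  by apply: (STU i t1) => //=; rewrite eqxx.
by apply: (STU s1 i) => //=; rewrite eqxx orbT.
Qed.

(** With [sum_co_le], this turns a count of superlevel sets at every level into an
    inequality between sums (layer cake). *)
Lemma sum_indic_card (I : finType) (q : I -> R) (l : R) : 0 <= l ->
  \sum_i 1 * \1_(`[0, q i[%classic) l = #|[set i | l < q i]%SET|%:R :> R.
Proof.
move=> l0; rewrite cardE -sum1_size natr_sum big_enum/= [RHS]big_mkcond/=.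
apply: eq_bigr => i _; rewrite mul1r indicE inE.
case: ifPn => li; first by rewrite mem_set//= in_itv/= l0 li.
by rewrite memNset//= in_itv/= l0/= (negbTE li).
Qed.

(** The Prekopa--Leindler inequality on the integers. After normalising [a] and
    [b] to have maximum [1], every superlevel set of [c] contains the sumset of
    the corresponding superlevel sets of [a] and [b]; summing over the levels
    bounds an arithmetic mean, which dominates the geometric one. *)
Lemma prekopa_leindler_nat N (a b : 'I_N -> R) (c : 'I_(N + N) -> R) :
  (forall s, 0 <= a s) -> (forall t, 0 <= b t) -> (forall u, 0 <= c u) ->
  (forall (s t : 'I_N) (u : 'I_(N + N)),
     (u == s + t :> nat)%N || (u == (s + t).+1 :> nat)%N ->
     a s * b t <= c u ^+ 2) ->
  4 * (\sum_s a s) * (\sum_t b t) <= (\sum_u c u) ^+ 2.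
Proof.
move=> a0 b0 c0 abc.
have [/forallP az|] := boolP [forall s, a s == 0].
  by rewrite big1 ?mulr0 ?mul0r ?sqr_ge0// => s _; apply/eqP.
rewrite negb_forall => /existsP[s0 as0].
have [/forallP bz|] := boolP [forall s, b s == 0].
  by rewrite [X in _ * X <= _]big1 ?mulr0 ?sqr_ge0// => s _; apply/eqP.
rewrite negb_forall => /existsP[t0 bt0].
pose s1 := [arg max_(s > s0) a s]%O; pose t1 := [arg max_(t > t0) b t]%O.
have s1max s : a s <= a s1 by rewrite /s1; case: arg_maxP => // i _; exact.
have t1max t : b t <= b t1 by rewrite /t1; case: arg_maxP => // i _; exact.
set al := a s1 in s1max *; set be := b t1 in t1max *.
have al0 : 0 < al by apply: lt_le_trans (s1max s0); rewrite lt_neqAle eq_sym as0 a0.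
have be0 : 0 < be by apply: lt_le_trans (t1max t0); rewrite lt_neqAle eq_sym bt0 b0.
pose ga := Num.sqrt (al * be).
have ga0 : 0 < ga by rewrite sqrtr_gt0 mulr_gt0.
have gaE : ga ^+ 2 = al * be by rewrite sqr_sqrtr// mulr_ge0 ?ltW.
have key : (\sum_s a s) / al + (\sum_t b t) / be <= (\sum_u c u) / ga.
  pose q (j : 'I_N + 'I_N) := match j with inl s => a s / al | inr t => b t / be end.
  rewrite !mulr_suml.
  have -> : \sum_s a s / al + \sum_t b t / be = \sum_j 1 * (q j - 0).
    by rewrite big_sumType; congr (_ + _); apply: eq_bigr => i _; rewrite mul1r subr0.
  have -> : \sum_u c u / ga = \sum_u 1 * (c u / ga - 0).
    by apply: eq_bigr => u _; rewrite mul1r subr0.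
  apply: sum_co_le => //.
  - by case=> j /=; rewrite divr_ge0// ltW.
  - by move=> u; rewrite divr_ge0// ltW.
  move=> l; rewrite big_sumType/=.
  have [l0|l0] := ltP l 0.
    rewrite !big1 ?addr0// => i _; rewrite indicE memNset ?mulr0//= in_itv/=;
    by rewrite leNgt l0.
  rewrite !sum_indic_card// -natrD ler_nat.
  have [l1|l1] := leP 1 l.
    have E (I : finType) (p : I -> R) : (forall i, p i <= 1) ->
        #|[set i | l < p i]%SET| = 0%N.
      move=> p1; apply/eqP; rewrite cards_eq0; apply/eqP/setP => i; rewrite !inE.
      by apply/negbTE; rewrite -leNgt (le_trans (p1 i)).
    by rewrite [X in (X + _)%N]E ?[X in (_ + X)%N]E// => i; rewrite ler_pdivrMr// mul1r.
  apply: card_sumset1.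
  - by apply/set0Pn; exists s1; rewrite inE divff ?gt_eqF.
  - by apply/set0Pn; exists t1; rewrite inE divff ?gt_eqF.
  move=> s t u; rewrite !inE !ltr_pdivlMr// => ls lt /abc abu.
  rewrite -(@ltr_pXn2r _ 2)// ?nnegrE ?mulr_ge0// ?ltW//.
  rewrite exprMn gaE; apply: lt_le_trans abu.
  rewrite expr2 mulrACA; apply: ltr_pM => //; rewrite mulr_ge0// ltW//.
have X0 : 0 <= \sum_s a s by apply: sumr_ge0.
have Y0 : 0 <= \sum_t b t by apply: sumr_ge0.
move: key; set X := \sum_s a s; set Y := \sum_t b t; set Z := \sum_u c u => key.
have Z0 : ga * (X / al + Y / be) <= Z by rewrite mulrC -ler_pdivlMr.
have W0 : 0 <= X / al + Y / be by rewrite addr_ge0 // divr_ge0// ltW.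
apply: (@le_trans _ _ ((ga * (X / al + Y / be)) ^+ 2)); last first.
  by rewrite lerXn2r ?nnegrE// ?(le_trans _ Z0)// mulr_ge0// ltW.
rewrite exprMn gaE.
have -> : 4 * X * Y = al * be * (4 * (X / al) * (Y / be)).
  by field; rewrite !gt_eqF.
rewrite ler_pM2l ?mulr_gt0//.
have := sqr_ge0 (X / al - Y / be); nra.
Qed.

Definition slice m N (A : {set m.+1.-tuple 'I_N}) (s : 'I_N) : {set m.-tuple 'I_N} :=
  [set x : m.-tuple 'I_N | cons_tuple s x \in A]%SET.

Lemma card_slices m N (A : {set m.+1.-tuple 'I_N}) :
  #|A| = (\sum_s #|slice A s|)%N.
Proof.
rewrite -sum1_card.
rewrite (reindex (fun p : 'I_N * m.-tuple 'I_N => cons_tuple p.1 p.2))/=; last first.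
  exists (fun x : m.+1.-tuple 'I_N => (thead x, behead_tuple x)) => [[s x] _|x _].
    by congr (_, _); apply: val_inj.
  by rewrite /= [RHS]tuple_eta.
rewrite -(pair_big_dep xpredT (fun s x => cons_tuple s x \in A) (fun _ _ => 1%N))/=.
by apply: eq_bigr => s _; rewrite -sum1_card; apply: eq_bigl => x; rewrite inE.
Qed.

(** Brunn--Minkowski for unions of grid cells: the sum of the unit cells with lower
    corners [a] and [b] is the union of the unit cells whose lower corners are [a + b]
    plus a vertex of the unit cube. The induction on the dimension applies the
    Prekopa--Leindler inequality to the cardinals of the slices. *)
Lemma card_sumset_cube m N (A B : {set m.-tuple 'I_N}) (C : {set m.-tuple 'I_(N + N)}) :
  (forall (a b : m.-tuple 'I_N) (c : m.-tuple 'I_(N + N)), a \in A -> b \in B ->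
    (forall i, (tnth c i == tnth a i + tnth b i :> nat)%N ||
               (tnth c i == (tnth a i + tnth b i).+1 :> nat)%N) -> c \in C) ->
  (4 ^ m * #|A| * #|B| <= #|C| ^ 2)%N.
Proof.
elim: m A B C => [|m IH] A B C ABC.
  have [->|/set0Pn[a aA]] := eqVneq A finset.set0; first by rewrite cards0 muln0.
  have [->|/set0Pn[b bB]] := eqVneq B finset.set0; first by rewrite cards0 muln0.
  have cC : [tuple] \in C by apply: (ABC a b) => // -[].
  have le1 K (D : {set 0.-tuple 'I_K}) : (#|D| <= 1)%N.
    by rewrite (leq_trans (max_card _))// card_tuple expn0.
  have C1 : (0 < #|C|)%N by apply/card_gt0P; exists [tuple].
  have := le1 _ A; have := le1 _ B; move: #|A| #|B| #|C| C1 => x y z; nia.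
rewrite -(ler_nat R) natrX !natrM expnSr !card_slices.
have := @prekopa_leindler_nat N (fun s => (4 ^ m)%:R * #|slice A s|%:R)
  (fun t => #|slice B t|%:R) (fun u => #|slice C u|%:R).
rewrite -mulr_sumr -!natr_sum natrM => PL.
rewrite (_ : _ * _ = 4 * ((4 ^ m)%:R * (\sum_s #|slice A s|)%:R) *
  (\sum_t #|slice B t|)%:R); last by ring.
apply: PL => // s t u stu.
rewrite -!natrM -natrX ler_nat; apply: IH => a b c; rewrite !inE => aA bB abc.
apply: (ABC _ _ _ aA bB) => i; case: (unliftP ord0 i) => [j ->|->].
  by rewrite !tnthS.
by rewrite !tnth0.
Qed.

End DiscreteBrunnMinkowski.

(** * Volume of balls *)

(** Passes to the limit in a bound that depends on a real parameter and is known for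
    slightly larger values of it. *)
Lemma lee_right_continuous (R : realType) (f : R -> R) (a : R) (x : \bar R) :
  {for a, continuous f} -> (forall b, a < b -> (x <= (f b)%:E)%E) -> (x <= (f a)%:E)%E.
Proof.
move=> fa xf; apply/lee_addgt0Pr => e e0.
have /cvgrPdist_lt/(_ e e0) := fa; rewrite near_nbhs => -[d /= d0 ad].
have lt_a : a < a + d / 2 by rewrite ltrDl divr_gt0.
apply: le_trans (xf _ lt_a) _; rewrite -EFinD lee_fin.
have : ball a d (a + d / 2).
  rewrite /ball/= opprD addNKr normrN gtr0_norm ?divr_gt0//.
  by rewrite ltr_pdivrMr// ltr_pMr// ltr1n.
by move=> /ad; rewrite distrC => /ltW /ler_normlW; rewrite lerBlDl.
Qed.

Section BallVolume.
Context {R : realType} {n : nat}.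
Implicit Types (A : set 'rV[R]_n).

Lemma lebesgue_le_sum (T : finType) (I : {set T}) (a b : T -> 'rV[R]_n) A :
  (forall t i, a t 0 i <= b t 0 i) ->
  (forall x, A x -> exists2 t, t \in I & box (a t) (b t) x) ->
  (lebesgue_rV A <= (\sum_(t in I) vol (a t) (b t))%:E)%E.
Proof.
move=> ab AI; apply: le_trans (@lebesgue_le_esum R n T [set` I] a b A _ _) _.
- by [].
- by move=> x /AI[t tI xt]; exists t.
rewrite esum_fset//; last by move=> t _; rewrite lee_fin vol_ge0.
rewrite -sumEFin -(@bigfs _ _ _ _ (index_enum T) (mem I))//.
  exact: index_enum_uniq.
by move=> t _; rewrite mem_index_enum.
Qed.

Lemma eball_scale (r : R) : 0 < r ->
  eball (0 : 'rV[R]_n) r = [set r *: x | x in eball 0 1].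
Proof.
move=> r0; apply/seteqP; split=> [x|_ [x] + <-]; rewrite /eball /= !subr0.
  move=> xr; exists (r^-1 *: x); last by rewrite scalerA divff ?scale1r// gt_eqF.
  by rewrite /= subr0 enormZ gtr0_norm ?invr_gt0// mulrC ltr_pdivrMr// mul1r.
by move=> x1; rewrite enormZ gtr0_norm// -[ltRHS]mulr1 ltr_pM2l.
Qed.

Lemma lebesgue_eball1_lty : (lebesgue_rV (eball (0 : 'rV[R]_n) 1) < +oo)%E.
Proof.
apply: (@le_lt_trans _ _ (vol (const_mx (-1)) (const_mx 1) : R)%:E); last exact: ltry.
apply: (@le_trans _ _ (lebesgue_rV (box (const_mx (-1)) (const_mx 1)))).
  apply: lebesgue_le => x; rewrite /eball/= subr0 => x1 i; rewrite !mxE -ler_norml.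
  exact: le_trans (ler_enorm_coord _ _) (ltW x1).
by apply: lebesgue_box => i; rewrite !mxE; lra.
Qed.

Lemma omega_ge0 : 0 <= omega n :> R.
Proof. by rewrite fine_ge0// lebesgue_rV_ge0. Qed.

Lemma lebesgue_eball1 : lebesgue_rV (eball (0 : 'rV[R]_n) 1) = (omega n)%:E.
Proof. by rewrite fineK// ge0_fin_numE ?lebesgue_rV_ge0 ?lebesgue_eball1_lty. Qed.

Lemma lebesgue_scale (t : R) A : 0 < t ->
  (lebesgue_rV [set t *: x | x in A] = (t ^+ n)%:E * lebesgue_rV A)%E.
Proof.
move=> t0; apply/eqP; rewrite eq_le lebesgue_scale_le//=.
have ti : 0 < t^-1 by rewrite invr_gt0.
have {1}-> : A = [set t^-1 *: x | x in [set t *: x | x in A]].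
  apply/seteqP; split=> [x Ax|_ [_ [x Ax <-] <-]].
    exists (t *: x); first by exists x.
    by rewrite scalerA mulVf ?scale1r// gt_eqF.
  by rewrite scalerA mulVf ?scale1r// gt_eqF.
apply: le_trans (lee_wpmul2l _ (lebesgue_scale_le _ ti)) _.
  by rewrite lee_fin exprn_ge0// ltW.
by rewrite muleA -EFinM exprVn divff ?mul1e// gt_eqF// exprn_gt0.
Qed.

Lemma lebesgue_eball (r : R) : 0 < r ->
  lebesgue_rV (eball (0 : 'rV[R]_n) r) = (omega n * r ^+ n)%:E.
Proof.
by move=> r0; rewrite eball_scale// lebesgue_scale// lebesgue_eball1 -EFinM mulrC.
Qed.

Lemma lebesgue_ge_box (a b : 'rV[R]_n) A : (forall i, a 0 i <= b 0 i) ->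
  (forall x : 'rV[R]_n, (forall i, a 0 i <= x 0 i < b 0 i) -> A x) ->
  ((vol a b)%:E <= lebesgue_rV A)%E.
Proof.
move=> ab abA; have := @lebesgue_ge_cells R n unit (fun=> a) (fun=> b) A.
rewrite (bigD1 tt)//= big1 ?addr0; last by case.
by apply=> // x [] [].
Qed.

Lemma lebesgue_eball_gt0 (x : 'rV[R]_n) (r : R) : 0 < r ->
  (0 < lebesgue_rV (eball x r))%E.
Proof.
move=> r0; pose c : 'rV[R]_n := const_mx (r / n.+1%:R).
have c0 i : 0 < c 0 i by rewrite mxE divr_gt0.
apply: (@lt_le_trans _ _ (vol x (x + c))%:E).
  by rewrite lte_fin; apply: prodr_gt0 => i _; rewrite mxE addrAC subrr add0r.
apply: lebesgue_ge_box => [i|y xy]; first by rewrite mxE lerDl ltW.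
apply: le_lt_trans (@enorm_ler_coord _ _ _ (r / n.+1%:R) _) _.
  move=> i; have := xy i; rewrite !mxE ler_norml => /andP[xy1 xy2].
  by have := c0 i; rewrite mxE; move: (r / _) xy2 => d; lra.
by rewrite mulrCA gtr_pMr// ltr_pdivrMr// mul1r ltr_nat.
Qed.

Lemma omega_gt0 : 0 < omega n :> R.
Proof. by rewrite -lte_fin -lebesgue_eball1 lebesgue_eball_gt0. Qed.

End BallVolume.

(** * The isodiametric inequality *)

Section Isodiametric.
Context {R : realType} {m : nat}.
Implicit Types (P : set 'rV[R]_m) (D : R).

(** With [A] the cells of size [e] that meet [P] and [C] the lower corners of the
    cells of the difference set, Brunn--Minkowski gives [2 ^ m * #|A| <= #|C|], while
    the cells in [C] lie in a ball of radius slightly larger than [D]. *)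
Lemma isodiametric_grid P D (N : nat) : (0 < N)%N -> 0 <= D ->
  (forall x y, P x -> P y -> enorm (x - y) <= D) ->
  (lebesgue_rV P <=
    (omega m * ((D + (2 * m%:R + 1) * (2 * (D + 1) / N%:R)) / 2) ^+ m)%:E)%E.
Proof.
move=> N0 D0 PD; set e := 2 * (D + 1) / N%:R; set rho := D + _.
have NR : 0 < N%:R :> R by rewrite ltr0n.
have e0 : 0 < e by rewrite divr_gt0// mulr_gt0// ltr_wpDl.
have rho0 : 0 < rho by rewrite ltr_wpDl// mulr_gt0// ltr_wpDl// mulr_ge0.
have [->|/set0P[x0 Px0]] := eqVneq P set0.
  by rewrite lebesgue0 lee_fin mulr_ge0 ?omega_ge0 ?exprn_ge0// divr_ge0// ltW.
pose p i := x0 0 i - (D + 1).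
pose lo (k : m.-tuple 'I_N) : 'rV[R]_m := \row_i (p i + e * (tnth k i)%:R).
pose hi (k : m.-tuple 'I_N) : 'rV[R]_m := \row_i (p i + e * ((tnth k i)%:R + 1)).
pose A := [set k : m.-tuple 'I_N | `[< exists2 x, P x & box (lo k) (hi k) x >]]%SET.
have lohi k i : lo k 0 i <= hi k 0 i by rewrite !mxE lerD2l ler_pM2l// lerDl.
have vole k : vol (lo k) (hi k) = e ^+ m.
  rewrite -[m in RHS]card_ord -prodr_const; apply: eq_bigr => i _.
  by rewrite !mxE; ring.
have PA : (lebesgue_rV P <= (e ^+ m * #|A|%:R)%:E)%E.
  have -> : e ^+ m * #|A|%:R = \sum_(k in A) vol (lo k) (hi k).
    by rewrite mulr_natr -sumr_const; apply: eq_bigr.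
  apply: lebesgue_le_sum => // x Px.
  pose t i := (x 0 i - p i) / e.
  have xp i : 0 <= x 0 i - p i < 2 * (D + 1).
    have := le_trans (ler_enorm_coord (x - x0) i) (PD _ _ Px Px0).
    by rewrite /p !mxE ler_norml => /andP[h1 h2]; lra.
  have t0 i : 0 <= t i by rewrite divr_ge0 ?(ltW e0)//; have /andP[] := xp i.
  have tN i : (Num.truncn (t i) < N)%N.
    rewrite truncn_lt_nat// ltr_pdivrMr// /e mulrCA mulfV ?gt_eqF// mulr1.
    by have /andP[] := xp i.
  pose k : m.-tuple 'I_N := [tuple Ordinal (tN i) | i < m].
  have xk : box (lo k) (hi k) x.
    move=> i; rewrite !mxE tnth_mktuple /=.
    have /andP[h1 h2] := truncn_itv (t0 i).
    have xE : x 0 i = p i + e * t i by rewrite /t mulrC divfK ?gt_eqF// subrKC.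
    rewrite xE !lerD2l !ler_pM2l// h1/=; apply: le_trans (ltW h2) _.
    by rewrite -natr1.
  by exists k => //; rewrite inE; apply/asboolP; exists x.
(* Reversing the coordinates turns differences of indices into sums, shifted by [N - 1]. *)
pose rv (k : m.-tuple 'I_N) : m.-tuple 'I_N := [tuple rev_ord (tnth k i) | i < m].
have rvK : involutive rv.
  by move=> k; apply: eq_from_tnth => i; rewrite !tnth_mktuple rev_ordK.
pose C := [set c : m.-tuple 'I_(N + N) | `[< exists a b, [/\ a \in A, rv b \in A &
  forall i, (tnth c i == tnth a i + tnth b i :> nat)%N ||
            (tnth c i == (tnth a i + tnth b i).+1 :> nat)%N] >]]%SET.
have AC : (2 ^ m * #|A| <= #|C|)%N.
  rewrite -(@leq_exp2r _ _ 2)// expnMn expnAC -[(#|A| ^ 2)%N]mulnn mulnA.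
  rewrite -[X in (_ * X <= _)%N](_ : #|[set rv x | x in A]%SET| = _); last first.
    by rewrite card_imset//; exact: inv_inj.
  apply: (card_sumset_cube (R := R)) => a b c aA /imsetP[b' b'A ->] abc.
  by rewrite inE; apply/asboolP; exists a, (rv b'); rewrite rvK.
pose q (c : m.-tuple 'I_(N + N)) : 'rV[R]_m := \row_i (e * ((tnth c i)%:R - N%:R)).
pose q' (c : m.-tuple 'I_(N + N)) : 'rV[R]_m := \row_i (e * ((tnth c i)%:R - N%:R + 1)).
have CB : e ^+ m * #|C|%:R <= omega m * rho ^+ m.
  rewrite -lee_fin -lebesgue_eball//.
  have -> : e ^+ m * #|C|%:R = \sum_(c : {c | c \in C}) vol (q (val c)) (q' (val c)).
    rewrite (eq_bigr (fun=> e ^+ m)); last first.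
      move=> c _; rewrite -[m in RHS]card_ord -prodr_const; apply: eq_bigr => i _.
      by rewrite !mxE; ring.
    by rewrite sumr_const card_sig mulr_natr.
  apply: lebesgue_ge_cells.
  - by move=> c i; rewrite !mxE ler_pM2l// lerDl.
  - move=> x c c' xc xc'; apply/val_inj/eq_from_tnth => i; apply/val_inj.
    have := xc i; have := xc' i; rewrite !mxE => /andP[h1 h2] /andP[h3 h4].
    have := le_lt_trans h1 h4; have := le_lt_trans h3 h2.
    rewrite !ltr_pM2l// => k1 k2; apply/eqP; rewrite eqn_leq.
    by apply/andP; split; rewrite -ltnS -(ltr_nat R) -natr1; lra.
  move=> J w; rewrite /eball /= subr0.
  move: (svalP J) => /=; move: (sval J) => c; rewrite inE => /asboolP[a [b [+ + abc]]].
  rewrite !inE => -[x Px xa] [y Py yb] wc.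
  apply: (@le_lt_trans _ _ (enorm (x - y) + enorm (w - (x - y)))).
    by rewrite -{1}(subrKC (x - y) w); exact: enormD.
  apply: (@le_lt_trans _ _ (D + m%:R * (2 * e))).
    apply: lerD; first exact: PD.
    apply: enorm_ler_coord => i.
    have := xa i; have := yb i; have := wc i; rewrite !mxE tnth_mktuple/=.
    have rb : ((N - (tnth b i).+1)%N%:R : R) = N%:R - (tnth b i)%:R - 1.
      by rewrite natrB// -natr1; ring.
    rewrite rb; have [cab|cab] : (tnth c i)%:R = (tnth a i)%:R + (tnth b i)%:R :> R \/
       (tnth c i)%:R = (tnth a i)%:R + (tnth b i)%:R + 1 :> R.
    - have /orP[/eqP|/eqP] := abc i => ->; first by left; rewrite natrD.
      by right; rewrite -natr1 natrD.
    - rewrite cab => /andP[h1 h2] /andP[h3 h4] /andP[h5 h6].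
      by rewrite ler_norml; apply/andP; split; lra.
    - rewrite cab => /andP[h1 h2] /andP[h3 h4] /andP[h5 h6].
      by rewrite ler_norml; apply/andP; split; lra.
  by rewrite /rho ltrD2l mulrA (mulrC m%:R) ltr_pM2r// ltrDl.
apply: le_trans PA _; rewrite lee_fin.
have -> : omega m * (rho / 2) ^+ m = omega m * rho ^+ m / 2 ^+ m.
  by rewrite expr_div_n mulrA.
rewrite ler_pdivlMr ?exprn_gt0//.
apply: le_trans CB; rewrite -mulrA ler_pM2l ?exprn_gt0// -natrX -natrM ler_nat mulnC.
exact: AC.
Qed.

(** By Brunn--Minkowski, [P] has at most the volume of half its difference set, which
    lies in a ball of radius [D / 2]; the error of the grid vanishes with its step. *)
Lemma isodiametric P D : 0 <= D ->
  (forall x y, P x -> P y -> enorm (x - y) <= D) ->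
  (lebesgue_rV P <= (omega m * (D / 2) ^+ m)%:E)%E.
Proof.
move=> D0 PD.
apply: (@lee_right_continuous _ (fun D' => omega m * (D' / 2) ^+ m)).
  apply: cvgM; first exact: cvg_cst.
  apply: (@continuous_comp _ _ _ (fun D' : R => D' / 2) (fun u => u ^+ m)).
    by apply: cvgM; [exact: cvg_id|exact: cvg_cst].
  exact: exprn_continuous.
move=> D' DD'; pose K := (2 * m%:R + 1) * (2 * (D + 1)) : R.
have K0 : 0 < K by rewrite mulr_gt0 ?mulr_gt0 ?ltr_wpDl ?mulr_ge0.
pose N := (Num.truncn (K / (D' - D))).+1.
have D'0 : 0 < D' - D by rewrite subr_gt0.
have /truncn_itv/andP[_ /ltW KN] : 0 <= K / (D' - D) by exact: ltW (divr_gt0 K0 D'0).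
have NK : K / N%:R <= D' - D by rewrite ler_pdivrMr// mulrC -ler_pdivrMr.
apply: le_trans (@isodiametric_grid P D N _ D0 PD) _ => //.
rewrite lee_fin ler_wpM2l ?omega_ge0// lerXn2r ?nnegrE//.
- by rewrite divr_ge0// addr_ge0// mulr_ge0 ?divr_ge0 ?addr_ge0 ?mulr_ge0 ?addr_ge0.
- by rewrite divr_ge0// (le_trans D0)// ltW.
- rewrite ler_pM2r// -lerBrDl; apply: le_trans NK.
  by rewrite /K !mulrA.
Qed.

End Isodiametric.

(** * Rotations as products of shears *)

Section Rotation.
Context {R : realType} {n : nat}.
Implicit Types (A : set 'rV[R]_n) (x y p : 'rV[R]_n).

Definition shear (i j : 'I_n) (c : R) x : 'rV[R]_n := x + (c * x 0 j) *: delta_mx 0 i.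

Lemma shearE i j c x l : shear i j c x 0 l = x 0 l + (if l == i then c * x 0 j else 0).
Proof. by rewrite !mxE eqxx/= mulr_natr; case: ifP => _; rewrite ?mulr1n ?mulr0n. Qed.

Lemma shearK i j c : i != j -> cancel (shear i j c) (shear i j (- c)).
Proof.
move=> ij x; apply/rowP => l; rewrite !shearE (eq_sym j) (negbTE ij) addr0.
by case: ifP => _; rewrite ?addr0// mulNr addrK.
Qed.

Lemma shear_linear i j c (a : R) x y :
  shear i j c (a *: x + y) = a *: shear i j c x + shear i j c y.
Proof. by apply/rowP => l; rewrite !(shearE, mxE); case: ifP => _; ring. Qed.

Lemma exists_slab (a w x : R) N : a <= x <= a + w * N.+1%:R ->
  exists k : 'I_N.+1, a + w * k%:R <= x <= a + w * (k%:R + 1).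
Proof.
elim: N => [|N IH] /andP[ax xw].
  by exists ord0; rewrite // mulr0 addr0 ax add0r.
have [xN|xN] := leP x (a + w * N.+1%:R).
  have [|k kx] := IH; first by rewrite ax xN.
  by exists (widen_ord (leqnSn _) k).
by exists ord_max; rewrite //= (ltW xN) natr1 xw.
Qed.

(** A sheared box is covered by sheared thin slabs, whose bounding boxes have
    almost the volume of the slabs. *)
Lemma lebesgue_shear_box i j c (a b : 'rV[R]_n) : i != j -> (forall l, a 0 l <= b 0 l) ->
  (lebesgue_rV [set shear i j c x | x in box a b] <= (vol a b)%:E)%E.
Proof.
move=> ij ab; have ji : (j == i) = false by rewrite eq_sym (negbTE ij).
pose V := \prod_(l | (l != i) && (l != j)) (b 0 l - a 0 l).
pose dj := b 0 j - a 0 j; pose di := b 0 i - a 0 i.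
have V0 : 0 <= V by apply: prodr_ge0 => l _; rewrite subr_ge0.
have dj0 : 0 <= dj by rewrite subr_ge0.
have di0 : 0 <= di by rewrite subr_ge0.
have volE : vol a b = di * (dj * V).
  by rewrite /vol (bigD1 i)//= (bigD1 j)//= ji.
apply: (@lee_right_continuous _ id) => [|v vab]; first exact: cvg_id.
pose K := V * dj * (2 * `|c| * dj).
have K0 : 0 <= K by rewrite !mulr_ge0.
pose N := Num.truncn (K / (v - vol a b)).
pose w := dj / N.+1%:R.
have w0 : 0 <= w by rewrite divr_ge0.
pose s (k : 'I_N.+1) := a 0 j + w * k%:R.
pose lo k : 'rV[R]_n := \row_l if l == i then a 0 i + c * s k - `|c| * w else
                  if l == j then s k else a 0 l.
pose hi k : 'rV[R]_n := \row_l if l == i then b 0 i + c * s k + `|c| * w else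
                  if l == j then s k + w else b 0 l.
have cw0 : 0 <= `|c| * w by rewrite mulr_ge0.
have lohi k l : lo k 0 l <= hi k 0 l.
  rewrite !mxE; have := ab l; case: eqP => [->|_]; first by move: cw0; lra.
  by case: eqP => //; rewrite lerDl.
have volk k : vol (lo k) (hi k) = (di + 2 * (`|c| * w)) * (w * V).
  rewrite /vol (bigD1 i)//= (bigD1 j)//= ?ji//; congr (_ * (_ * _)).
  - by rewrite !mxE eqxx /di; ring.
  - by rewrite !mxE ji eqxx; ring.
  - by apply: eq_bigr => l /andP[/negbTE li /negbTE lj]; rewrite !mxE li lj.
apply: le_trans (@lebesgue_le_sum R n 'I_N.+1 finset.setT lo hi _ lohi _) _.
  move=> _ [x xab <-]; have [|k /andP[k1 k2]] := @exists_slab (a 0 j) w (x 0 j) N.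
    by rewrite /w divfK ?gt_eqF// /dj subrKC; exact: xab.
  exists k; first by rewrite inE.
  move=> l; rewrite shearE !mxE; case: eqP => [->|_].
    have /andP[xi1 xi2] := xab i.
    have : `|c * (x 0 j - s k)| <= `|c| * w.
      rewrite normrM ler_wpM2l// ger0_norm ?subr_ge0// lerBlDl /s -addrA.
      by rewrite -[X in _ + (_ + X)]mulr1 -mulrDr.
    by rewrite ler_norml mulrBr => /andP[h1 h2]; apply/andP; split; lra.
  rewrite addr0; case: eqP => [->|_]; last exact: xab.
  by rewrite k1/= /s -addrA -[X in _ + (_ + X)]mulr1 -mulrDr.
rewrite lee_fin (eq_bigr _ (fun k _ => volk k)) sumr_const cardsT card_ord.
rewrite -[_ *+ N.+1]mulr_natl.
have -> : N.+1%:R * ((di + 2 * (`|c| * w)) * (w * V)) = vol a b + K / N.+1%:R.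
  by rewrite volE /K /w; field; rewrite gt_eqF// ltr0n.
have v0 : 0 < v - vol a b by rewrite subr_gt0.
have /truncn_itv/andP[_ /ltW KN] : 0 <= K / (v - vol a b)
  by apply: divr_ge0 => //; exact: ltW.
by rewrite -lerBrDl ler_pdivrMr// mulrC -ler_pdivrMr.
Qed.

Lemma lebesgue_shear_le i j c A : i != j ->
  (lebesgue_rV [set shear i j c x | x in A] <= lebesgue_rV A)%E.
Proof.
move=> ij; have [->|Aoo] := eqVneq (lebesgue_rV A) +oo%E; first exact: leey.
apply/lee_addgt0Pr => e e0.
have [|I [a [b [ab AI le]]]] := lebesgue_cover (A := A) _ e0; first by rewrite ltey.
apply: le_trans le.
pose F k : set 'rV[R]_n := [set y | I k /\ [set shear i j c x | x in box (a k) (b k)] y].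
apply: (@le_trans _ _ (lebesgue_rV (\bigcup_k F k))).
  by apply: lebesgue_le => _ [x /AI[k Ik xk] <-]; exists k => //; split=> //; exists x.
apply: le_trans (lebesgue_bigcup _) _.
rewrite nneseries_esumT; last by move=> k; exact: lebesgue_rV_ge0.
rewrite [leRHS]esum_mkcond; apply: le_esum => k _; case: ifPn => [_|/negP Ik].
  apply: le_trans (lebesgue_shear_box c ij (ab k)).
  by apply: lebesgue_le => y [].
have -> : F k = set0 by apply/seteqP; split=> // y [/mem_set/Ik].
by rewrite lebesgue0.
Qed.

Lemma lebesgue_shear_ge i j c A : i != j ->
  (lebesgue_rV A <= lebesgue_rV [set shear i j c x | x in A])%E.
Proof.
move=> ij; apply: le_trans (lebesgue_shear_le (- c) _ ij).
apply: lebesgue_le => x Ax; exists (shear i j c x); first by exists x.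
by rewrite shearK.
Qed.

(** The matrix of the rotation of cosine [c] and sine [s] is the product of the shears
    of parameters [- t], [s] and [- t], where [t = (1 - c) / s] is the tangent of half
    the angle, so that no volume is lost. *)
Lemma plane_rotation i j p : i != j -> p 0 i != 0 ->
  exists g : 'rV[R]_n -> 'rV[R]_n,
  [/\ forall a x y, g (a *: x + y) = a *: g x + g y,
      forall x, dot (g x) (g x) = dot x x,
      forall A, (lebesgue_rV A <= lebesgue_rV (g @` A))%E,
      g p 0 i = 0
    & forall x l, l != i -> l != j -> g x 0 l = x 0 l].
Proof.
move=> ij pi0; have ji : j != i by rewrite eq_sym.
have r0 : 0 < p 0 i ^+ 2 + p 0 j ^+ 2.
  by rewrite ltr_pwDl ?sqr_ge0// lt_neqAle eq_sym sqrf_eq0 pi0 sqr_ge0.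
pose r := Num.sqrt (p 0 i ^+ 2 + p 0 j ^+ 2).
have rp : 0 < r by rewrite sqrtr_gt0.
have rE : r ^+ 2 = p 0 i ^+ 2 + p 0 j ^+ 2 by rewrite sqr_sqrtr// ltW.
pose s := p 0 i / r; pose c := p 0 j / r; pose t := (1 - c) / s.
have s0 : s != 0 by rewrite mulf_neq0// invr_eq0 gt_eqF.
have cs : c ^+ 2 + s ^+ 2 = 1.
  by rewrite !expr_div_n -mulrDl rE addrC divff// gt_eqF.
have ts : t * s = 1 - c by rewrite divfK.
have tc : t * (1 + c) = s.
  apply: (mulIf s0); rewrite mulrAC ts -expr2.
  have -> : s ^+ 2 = 1 - c ^+ 2 by rewrite -cs; ring.
  ring.
pose g x := shear i j (- t) (shear j i s (shear i j (- t) x)).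
have gi x : g x 0 i = c * x 0 i - s * x 0 j.
  rewrite /g !shearE !eqxx ?(negbTE ij) ?(negbTE ji) !addr0.
  transitivity ((1 - t * s) * x 0 i - t * (2 - t * s) * x 0 j); first ring.
  by rewrite ts -tc; ring.
have gj x : g x 0 j = s * x 0 i + c * x 0 j.
  rewrite /g !shearE !eqxx ?(negbTE ij) ?(negbTE ji) !addr0.
  transitivity (s * x 0 i + (1 - t * s) * x 0 j); first ring.
  by rewrite ts; ring.
have gl x l : l != i -> l != j -> g x 0 l = x 0 l.
  by move=> /negbTE li /negbTE lj; rewrite /g !shearE li lj !addr0.
exists g; split=> //.
- by move=> a x y; rewrite /g !shear_linear.
- move=> x; rewrite /dot (bigD1 i)//= (bigD1 j)//= [RHS](bigD1 i)//= [in RHS](bigD1 j)//=.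
  rewrite !addrA; congr (_ + _).
    transitivity ((c ^+ 2 + s ^+ 2) * (x 0 i * x 0 i + x 0 j * x 0 j)).
      by rewrite gi gj; ring.
    by rewrite cs mul1r.
  by apply: eq_bigr => l /andP[li lj]; rewrite gl.
- move=> A; apply: le_trans (lebesgue_shear_ge (- t) A ij) _.
  apply: le_trans (lebesgue_shear_ge s _ ji) _.
  apply: le_trans (lebesgue_shear_ge (- t) _ ij) _.
  by apply: lebesgue_le => _ [_ [_ [x Ax <-] <-] <-]; exists x.
- by rewrite gi /c /s; ring.
Qed.

(** The coordinates of [p] other than [i0] are cancelled one after the other by plane
    rotations. This replaces the rotation invariance of the volume. *)
Lemma rotate_to_axis (i0 : 'I_n) p :
  exists g : 'rV[R]_n -> 'rV[R]_n,
  [/\ forall a x y, g (a *: x + y) = a *: g x + g y,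
      forall x, dot (g x) (g x) = dot x x,
      forall A, (lebesgue_rV A <= lebesgue_rV (g @` A))%E
    & forall i, i != i0 -> g p 0 i = 0].
Proof.
suff [g [gl gd gA gp]] : exists g : 'rV[R]_n -> 'rV[R]_n,
  [/\ forall a x y, g (a *: x + y) = a *: g x + g y,
      forall x, dot (g x) (g x) = dot x x,
      forall A, (lebesgue_rV A <= lebesgue_rV (g @` A))%E
    & forall i, i \in enum 'I_n -> i != i0 -> g p 0 i = 0].
  by exists g; split=> // i; apply: gp; rewrite mem_enum.
elim: (enum 'I_n) => [|i s [g [gl gd gA gp]]].
  by exists id; split=> // A; apply: lebesgue_le => x Ax; exists x.
have [->|ii0] := eqVneq i i0.
  by exists g; split=> // l; rewrite inE => /predU1P[->|/gp//]; rewrite eqxx.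
have [gpi|gpi] := eqVneq (g p 0 i) 0.
  by exists g; split=> // l; rewrite inE => /predU1P[->|/gp//].
have [h [hl hd hA hp hx]] := plane_rotation ii0 gpi.
exists (h \o g); split=> [a x y|x|A|l] /=.
- by rewrite gl hl.
- by rewrite hd gd.
- apply: le_trans (gA A) _; apply: le_trans (hA _) _.
  by apply: lebesgue_le => _ [_ [x Ax <-] <-]; exists x.
- have [->|li] := eqVneq l i; first by rewrite hp.
  by rewrite inE (negbTE li)/= => ls li0; rewrite hx// gp.
Qed.

End Rotation.

(** * Volume of cones *)

Section Cylinder.
Context {R : realType} {m : nat}.

Definition tail (x : 'rV[R]_m.+1) : 'rV[R]_m := \row_j x 0 (lift ord0 j).

Lemma enorm_tail x : enorm (tail x) <= enorm x.
Proof.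
apply: ler_wsqrtr; rewrite [leRHS]big_ord_recl /dot.
by under eq_bigr do rewrite !mxE; rewrite lerDr -expr2 sqr_ge0.
Qed.

Lemma tail_linear (a : R) x y : tail (a *: x + y) = a *: tail x + tail y.
Proof. by apply/rowP => j; rewrite !mxE. Qed.

Lemma lebesgue_cylinder (P : set 'rV[R]_m) (lo hi : R) : lo <= hi ->
  (lebesgue_rV P < +oo)%E ->
  (lebesgue_rV [set x | P (tail x) /\ (lo <= x 0 ord0 <= hi)%R] <=
   (hi - lo)%:E * lebesgue_rV P)%E.
Proof.
move=> lohi Poo; have w0 : 0 <= hi - lo by rewrite subr_ge0.
pose glue (t : R) (y : 'rV[R]_m) : 'rV[R]_m.+1 :=
  \row_i if unlift ord0 i is Some j then y 0 j else t.
have glue0 t y : glue t y 0 ord0 = t by rewrite mxE unlift_none.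
have glueS t y j : glue t y 0 (lift ord0 j) = y 0 j by rewrite mxE liftK.
have le e : 0 < e -> (lebesgue_rV [set x | P (tail x) /\ (lo <= x 0 ord0 <= hi)%R] <=
    (hi - lo)%:E * (lebesgue_rV P + e%:E))%E.
  move=> e0; have [I [a [b [ab PI le]]]] := lebesgue_cover Poo e0.
  apply: le_trans (lee_wpmul2l _ le); rewrite ?lee_fin//.
  apply: le_trans (esum_Zl_le _ w0 _); last by move=> k; rewrite lee_fin vol_ge0.
  apply: (@le_trans _ _ (\esum_(k in I) (vol (glue lo (a k)) (glue hi (b k)))%:E)).
    apply: lebesgue_le_esum => [k _ i|x [/PI[k Ik xk] x0]].
      by case: (unliftP ord0 i) => [j ->|->]; rewrite ?glueS ?glue0.
    exists k => // i; case: (unliftP ord0 i) => [j ->|->]; rewrite ?glueS ?glue0//.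
    by have := xk j; rewrite mxE.
  apply: le_esum => k _; rewrite -EFinM lee_fin /vol big_ord_recl !glue0.
  by under eq_bigr do rewrite !glueS.
have Pfin : lebesgue_rV P \is a fin_num by rewrite ge0_fin_numE ?lebesgue_rV_ge0.
rewrite -(fineK Pfin) -EFinM; rewrite -[fine _]addr0.
apply: (@lee_right_continuous _ (fun e => (hi - lo) * (fine (lebesgue_rV P) + e))).
  apply: cvgM; first exact: cvg_cst.
  by apply: cvgD; [exact: cvg_cst|exact: cvg_id].
by move=> e /le; rewrite -{1}(fineK Pfin) -EFinD -EFinM.
Qed.

End Cylinder.

Section Cone.
Context {R : realType} {n : nat}.
Implicit Types (A : set 'rV[R]_n) (r h : R).

(** The part of the shell between the radii [r] and [r + h] that is seen from
    [x0] through [A], translated so that [x0] becomes the origin: only balls centred there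
    have a volume known from the start. *)
Definition cone (x0 : 'rV[R]_n) r h A : set 'rV[R]_n :=
  [set x | (r <= enorm x <= r + h)%R /\
     exists a t, [/\ A a, (0 < t)%R & x = t *: (a - x0)] ].

(** If [g] is the cosine of the angle of [u] and [v], the square of the right-hand side
    is [(|u| - |v|) ^ 2 + 2 |u| |v| (1 - g)], at least the square [2 r ^ 2 (1 - g)] of
    the left-hand side. *)
Lemma enorm_retract r (u v : 'rV[R]_n) : 0 < r -> r <= enorm u -> r <= enorm v ->
  enorm ((r / enorm u) *: u - (r / enorm v) *: v) <= enorm (u - v).
Proof.
move=> r0 ru rv; apply: ler_wsqrtr.
have u0 : 0 < enorm u by exact: lt_le_trans ru.
have v0 : 0 < enorm v by exact: lt_le_trans rv.
rewrite !dotE (dotC v u) -!sqr_enorm.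
have := cauchy_schwarz u v.
move: (enorm u) (enorm v) (dot u v) u0 v0 ru rv => a b c a0 b0 ra rb cab.
rewrite [leLHS](_ : _ = 2 * r ^+ 2 * (a * b - c) / (a * b)); last first.
  by field; rewrite !gt_eqF.
rewrite ler_pdivrMr ?mulr_gt0//.
have rab : r ^+ 2 <= a * b by rewrite expr2 ler_pM// ltW.
have ab2 : 2 * (a * b - c) <= a ^+ 2 - c - (c - b ^+ 2).
  by have := sqr_ge0 (a - b); rewrite sqrrB; lra.
have c0 : 0 <= 2 * (a * b - c) by rewrite mulr_ge0// subr_ge0.
rewrite [leRHS](_ : _ = (a ^+ 2 - c - (c - b ^+ 2)) * (a * b)); last by ring.
apply: (@le_trans _ _ (2 * (a * b - c) * (a * b))).
  by rewrite [leLHS](_ : _ = 2 * (a * b - c) * r ^+ 2) ?ler_wpM2l//; ring.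
by rewrite ler_wpM2r// mulr_ge0 // ltW.
Qed.

End Cone.

Section ConePiece.
Context {R : realType} {m : nat}.
Implicit Types (A : set 'rV[R]_m.+1) (r h d : R).

(** After a rotation that moves one point of the retracted set to the first axis,
    the cone over a small set lies in a cylinder over its projection, to which the
    isodiametric inequality applies. *)
Lemma lebesgue_cone_piece A (x0 : 'rV[R]_m.+1) r h d :
  0 < r -> 0 < h -> 0 <= d -> d <= r ->
  (forall a, A a -> r <= enorm (a - x0)) ->
  (forall a b, A a -> A b -> enorm (a - b) <= d) ->
  (lebesgue_rV (cone x0 r h A) <=
    ((h + d) * (omega m * ((1 + 2 * h / r) * d / 2) ^+ m))%:E)%E.
Proof.
move=> r0 h0 d0 dr Ar Ad.
have hr0 : 0 < h / r by rewrite divr_gt0.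
have [->|/set0P[a0 Aa0]] := eqVneq A set0.
  have -> : cone x0 r h set0 = set0 by apply/seteqP; split=> // x [_ [a [t []]]].
  rewrite lebesgue0 lee_fin !mulr_ge0 ?omega_ge0 ?exprn_ge0 ?addr_ge0 ?divr_ge0//.
    exact: ltW.
  by rewrite !mulr_ge0// addr_ge0// -mulrA mulr_ge0 // ltW.
pose hat a := (r / enorm (a - x0)) *: (a - x0).
have hatd a b : A a -> A b -> enorm (hat a - hat b) <= d.
  move=> Aa Ab; apply: le_trans (enorm_retract r0 (Ar _ Aa) (Ar _ Ab)) _.
  by rewrite opprB addrA subrK; exact: Ad.
have hatr a : A a -> enorm (hat a) = r.
  move=> /Ar ra; have a1 := lt_le_trans r0 ra.
  by rewrite enormZ ger0_norm ?divr_ge0 ?ltW// divfK// gt_eqF.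
have [g [gl gd gA g0]] := rotate_to_axis ord0 (hat a0).
have gE x : enorm (g x) = enorm x by rewrite /enorm gd.
have gZ t x : g (t *: x) = t *: g x.
  have := gl (-1) x x; rewrite scaleN1r addNr scaleN1r addNr => gz.
  by rewrite -[t *: x]addr0 gl gz addr0.
have gB x y : g (x - y) = g x - g y by rewrite addrC -scaleN1r gl scaleN1r addrC.
pose T x := tail (g x).
have TB x y : T (x - y) = T x - T y.
  by rewrite /T gB addrC -scaleN1r tail_linear scaleN1r addrC.
have TZ t x : T (t *: x) = t *: T x.
  by rewrite /T gZ; apply/rowP => j; rewrite !mxE.
have TE x : enorm (T x) <= enorm x by rewrite -(gE x) enorm_tail.
have T0 : T (hat a0) = 0 by apply/rowP => j; rewrite !mxE g0.
have coneE x : cone x0 r h A x ->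
    exists t a, [/\ 1 <= t, t <= 1 + h / r, A a & x = t *: hat a].
  move=> [/andP[rx xr] [a [t [Aa t0 xE]]]]; have a1 := lt_le_trans r0 (Ar _ Aa).
  exists (enorm x / r), a; split=> //.
  - by rewrite ler_pdivlMr ?mul1r.
  - by rewrite ler_pdivrMr// mulrDl mul1r divfK ?gt_eqF.
  - rewrite /hat scalerA {1}xE; congr (_ *: _).
    by rewrite xE enormZ gtr0_norm//; field; rewrite !gt_eqF.
pose D := (1 + 2 * h / r) * d.
have D0 : 0 <= D by rewrite mulr_ge0// addr_ge0// -mulrA mulr_ge0// ltW.
have iso := @isodiametric R m [set T x | x in cone x0 r h A] D D0.
have {}iso : (lebesgue_rV [set T x | x in cone x0 r h A] <=
    (omega m * (D / 2) ^+ m)%:E)%E.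
  apply: iso => _ _ [_ /coneE[t [a [t1 th Aa ->]]] <-] [_ /coneE[s [b [s1 sh Ab ->]]] <-].
  rewrite (TZ t) (TZ s).
  have -> : t *: T (hat a) - s *: T (hat b) =
      t *: (T (hat a) - T (hat b)) + (t - s) *: (T (hat b) - T (hat a0)).
    by rewrite T0 subr0 scalerBr scalerBl addrA subrK.
  apply: le_trans (enormD _ _) _; rewrite !enormZ -!TB.
  have n1 := le_trans (TE _) (hatd _ _ Aa Ab).
  have n2 := le_trans (TE _) (hatd _ _ Ab Aa0).
  have t0 : 0 <= t by lra.
  rewrite /D (_ : _ * d = (1 + h / r) * d + (h / r) * d); last by ring.
  rewrite (ger0_norm t0); apply: lerD; apply: ler_pM => //; rewrite ?enorm_ge0//.
  by rewrite ler_norml; apply/andP; split; lra.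
(* The cone is caught between two hyperplanes orthogonal to the axis; the axis may be
   oriented either way. *)
have a00 : g (hat a0) 0 ord0 ^+ 2 = r ^+ 2.
  rewrite -(hatr _ Aa0) -gE sqr_enorm /dot (bigD1 ord0)//= big1 ?addr0 ?expr2//.
  by move=> i i0; rewrite g0 ?mulr0.
have [lo [hi [lohi gx]]] : exists lo hi, hi - lo = h + d /\
    forall x, cone x0 r h A x -> lo <= g x 0 ord0 <= hi.
  have near a : A a -> `|g (hat a) 0 ord0 - g (hat a0) 0 ord0| <= d /\
      `|g (hat a) 0 ord0| <= r.
    move=> Aa; split; last by rewrite -(hatr _ Aa) -gE ler_enorm_coord.
    apply: le_trans (hatd _ _ Aa Aa0); rewrite -gE gB.
    by apply: le_trans (ler_enorm_coord _ ord0); rewrite !mxE.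
  move/eqP: a00; rewrite eqf_sqr => /orP[|] /eqP a00.
    exists (r - d), (r + h); split; first by ring.
    move=> _ /coneE[t [a [t1 th Aa ->]]]; rewrite gZ mxE.
    have [] := near a Aa; rewrite a00 !ler_norml => /andP[h1 h2] /andP[h3 h4].
    have hrr : h / r * r = h by rewrite divfK ?gt_eqF.
    move: (g (hat a) 0 ord0) (h / r) h1 h2 h3 h4 hrr th => v q h1 h2 h3 h4 hrr th.
    by apply/andP; split; nra.
  exists (- (r + h)), (- (r - d)); split; first by ring.
  move=> _ /coneE[t [a [t1 th Aa ->]]]; rewrite gZ mxE.
  have [] := near a Aa; rewrite a00 !ler_norml => /andP[h1 h2] /andP[h3 h4].
  have hrr : h / r * r = h by rewrite divfK ?gt_eqF.
  move: (g (hat a) 0 ord0) (h / r) h1 h2 h3 h4 hrr th => v q h1 h2 h3 h4 hrr th.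
  by apply/andP; split; nra.
apply: le_trans (gA _) _.
pose P := [set T x | x in cone x0 r h A].
apply: (@le_trans _ _ (lebesgue_rV [set x | P (tail x) /\ (lo <= x 0 ord0 <= hi)%R])).
  by apply: lebesgue_le => _ [x cx <-]; split; [exists x|exact: gx].
apply: le_trans (lebesgue_cylinder _ _) _.
- by rewrite -subr_ge0 lohi addr_ge0// ltW.
- by apply: le_lt_trans iso _; rewrite ltry.
rewrite lohi EFinM; apply: lee_wpmul2l iso.
by rewrite lee_fin addr_ge0// ltW.
Qed.

End ConePiece.

Lemma hausdorff_delta_le_hausdorff (R : realType) (n s : nat) (d : R)
    (A : set 'rV[R]_n) : 0 < d ->
  (hausdorff_delta s d A <= hausdorff s A)%E.
Proof. by move=> d0; apply: ereal_sup_ubound; exists d. Qed.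

Section ConeHausdorff.
Context {R : realType} {m : nat}.
Implicit Types (A : set 'rV[R]_m.+1) (r h d : R).

Lemma lebesgue_cone_gauge A (x0 : 'rV[R]_m.+1) r h d (U : set 'rV[R]_m.+1) :
  0 < r -> 0 < h -> d <= r ->
  (forall a, A a -> r <= enorm (a - x0)) -> (ediam U <= d%:E)%E ->
  (lebesgue_rV (cone x0 r h (A `&` U)) <=
    ((h + d) * (1 + 2 * h / r) ^+ m)%:E * hausdorff_gauge m U)%E.
Proof.
move=> r0 h0 dr Ar Ud; rewrite /hausdorff_gauge.
have Ufin : ediam U \is a fin_num.
  by rewrite ge0_fin_numE ?ediam_ge0// (le_lt_trans Ud)// ltry.
have d'0 : 0 <= fine (ediam U) by rewrite fine_ge0// ediam_ge0.
have d'd : fine (ediam U) <= d by rewrite -lee_fin fineK.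
have [->|/set0P[u Uu]] := eqVneq U set0.
  have -> : cone x0 r h (A `&` set0) = set0.
    by rewrite setI0; apply/seteqP; split=> // x [_ [a [t []]]].
  by rewrite lebesgue0 mule0.
apply: le_trans (lebesgue_cone_piece r0 h0 d'0 (le_trans d'd dr) _ _) _.
- by move=> a [/Ar].
- move=> a b [_ Ua] [_ Ub]; rewrite -lee_fin fineK//.
  by apply: ereal_sup_ubound; right; exists a => //; exists b.
rewrite -(fineK Ufin) -EFin_expe -!EFinM lee_fin /=.
move: (fine _) d'0 d'd => e e0 ed.
have q0 : 0 <= 2 * h / r by rewrite divr_ge0 ?mulr_ge0// ltW.
have w0 : 0 <= omega m :> R by exact: omega_ge0.
have -> : (1 + 2 * h / r) * e / 2 = (1 + 2 * h / r) * (e / 2) by rewrite mulrA.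
rewrite exprMn expr_div_n.
have -> : (h + d) * (1 + 2 * h / r) ^+ m * (omega m / 2 ^+ m * e ^+ m) =
  (h + d) * (omega m * ((1 + 2 * h / r) ^+ m * (e ^+ m / 2 ^+ m))) by ring.
apply: ler_wpM2r; last by rewrite lerD2l.
by rewrite !mulr_ge0 ?exprn_ge0 ?divr_ge0 ?exprn_ge0 ?addr_ge0.
Qed.

(** Cover [A] by sets of diameter at most [d] and sum the bounds on the pieces. The
    diameter enters the sum only through the height [h + d], hence disappears as [d]
    tends to [0]. *)
Lemma lebesgue_cone_hausdorff A (x0 : 'rV[R]_m.+1) r h : 0 < r -> 0 < h ->
  (forall a, A a -> r <= enorm (a - x0)) ->
  (lebesgue_rV (cone x0 r h A) <= (h * (1 + 2 * h / r) ^+ m)%:E * hausdorff m A)%E.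
Proof.
move=> r0 h0 Ar; pose c := (1 + 2 * h / r) ^+ m.
have c0 : 0 < c by rewrite exprn_gt0// ltr_wpDr// divr_ge0 ?mulr_ge0// ltW.
have H0 : (0 <= hausdorff m A)%E by exact: outer_measure_ge0.
have [->|Hoo] := eqVneq (hausdorff m A) +oo%E.
  by rewrite gt0_muley ?leey// lte_fin mulr_gt0.
have Hfin : hausdorff m A \is a fin_num by rewrite ge0_fin_numE// ltey.
rewrite -(fineK Hfin) -EFinM.
rewrite [X in X%:E](_ : _ = (h + 0) * c * fine (hausdorff m A)); last first.
  by rewrite addr0.
have fH0 : 0 <= fine (hausdorff m A) by rewrite fine_ge0.
apply: (@lee_right_continuous _ (fun d => (h + d) * c * fine (hausdorff m A))).
  apply: cvgM; last exact: cvg_cst.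
  apply: cvgM; last exact: cvg_cst.
  by apply: cvgD; [exact: cvg_cst|exact: cvg_id].
move=> b b0; pose d := Num.min b r.
have d0 : 0 < d by rewrite lt_min b0.
have hd0 : 0 < (h + d) * c by rewrite mulr_gt0// addr_gt0.
apply: (@le_trans _ _ (((h + d) * c)%:E * hausdorff m A)%E); last first.
  rewrite -(fineK Hfin) -EFinM lee_fin; apply: ler_wpM2r => //.
  apply: ler_wpM2r; first exact: ltW.
  by rewrite lerD2l ge_min lexx.
apply: le_trans (lee_wpmul2l _ (hausdorff_delta_le_hausdorff m A d0)); last first.
  by rewrite lee_fin ltW.
rewrite -lee_pdivrMl//; apply: le_ereal_inf_tmp => _ [U [Ud AU] <-].
rewrite lee_pdivrMl//.
apply: (@le_trans _ _ (lebesgue_rV (\bigcup_k cone x0 r h (A `&` U k)))).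
  apply: lebesgue_le => x [xr [a [t [Aa t0 xE]]]].
  by have [k _ Uk] := AU _ Aa; exists k => //; split=> //; exists a, t.
apply: le_trans (lebesgue_bigcup _) _.
rewrite -nneseriesZl//; last by move=> k _; exact: hausdorff_gauge_ge0.
apply: lee_nneseries => [k _ _|k _]; first exact: lebesgue_rV_ge0.
by apply: lebesgue_cone_gauge => //; rewrite ge_min lexx orbT.
Qed.

End ConeHausdorff.

(** * Lower bounds of Hausdorff measures *)

Section HausdorffLowerBounds.
Context {R : realType} {m : nat}.
Implicit Types (A : set 'rV[R]_m.+1) (r h : R).

Definition sees A (x0 v : 'rV[R]_m.+1) : Prop :=
  exists a t, [/\ A a, (0 < t)%R & v = t *: (a - x0)].

Lemma bernoulli_expr r h (k : nat) : 0 <= r -> 0 <= h ->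
  r ^+ k.+1 + k.+1%:R * r ^+ k * h <= (r + h) ^+ k.+1.
Proof.
move=> r0 h0; elim: k => [|k IH]; first by rewrite !expr1 mul1r expr0 mul1r.
rewrite [leRHS]exprS; apply: le_trans (ler_wpM2l _ IH); last exact: addr_ge0.
have hk : 0 <= k.+1%:R * r ^+ k * (h * h) by rewrite !mulr_ge0 ?exprn_ge0.
rewrite -subr_ge0 [X in 0 <= X](_ : _ = k.+1%:R * r ^+ k * (h * h))//.
by rewrite -[k.+2%:R]natr1 !exprS; ring.
Qed.

(** Here the cone is the whole shell, of volume at least [h] times the area of the
    sphere. Dividing the cone bound by [h] and letting [h] tend to [0] gives the claim;
    the constant is sharp only thanks to the isodiametric inequality. *)
Lemma hausdorff_ge_sphere A (x0 : 'rV[R]_m.+1) r : 0 < r ->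
  (forall a, A a -> r <= enorm (a - x0)) ->
  (forall v, v != 0 -> sees A x0 v) ->
  ((m.+1%:R * omega m.+1 * r ^+ m)%:E <= hausdorff m A)%E.
Proof.
move=> r0 Ar Asee; have H0 : (0 <= hausdorff m A)%E by exact: outer_measure_ge0.
have [->|Hoo] := eqVneq (hausdorff m A) +oo%E; first exact: leey.
have [F HF] : exists F, hausdorff m A = F%:E.
  by exists (fine (hausdorff m A)); rewrite fineK// ge0_fin_numE// ltey.
rewrite HF (_ : F = (1 + 0 / r) ^+ m * F); last by rewrite mul0r addr0 expr1n mul1r.
apply: (@lee_right_continuous _ (fun h => (1 + h / r) ^+ m * F)).
  apply: cvgM; last exact: cvg_cst.
  apply: (@continuous_comp _ _ _ (fun h : R => 1 + h / r) (fun u => u ^+ m)).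
    by apply: cvgD; [exact: cvg_cst|apply: cvgM; [exact: cvg_id|exact: cvg_cst]].
  exact: exprn_continuous.
move=> k k0; pose h := k / 2; have h0 : 0 < h by rewrite divr_gt0.
have kE : k = 2 * h by rewrite mulrC divfK.
have := lebesgue_cone_hausdorff r0 h0 Ar; rewrite HF -EFinM => le.
have : (lebesgue_rV (eball (0 : 'rV[R]_m.+1) (r + h)) <=
    lebesgue_rV (eball (0 : 'rV[R]_m.+1) r) + lebesgue_rV (cone x0 r h A))%E.
  apply: le_trans (lebesgueU _ _); apply: lebesgue_le => x; rewrite /eball/= subr0 => xrh.
  have [xr|rx] := ltP (enorm x) r; [by left|right; split; first by rewrite rx ltW].
  by apply: Asee; apply: contraTneq rx => ->; rewrite enorm0 -ltNge.
rewrite !lebesgue_eball ?addr_gt0// => le'.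
have {le le'} := le_trans le' (leeD2l _ le).
rewrite -EFinD !lee_fin -lerBlDl -mulrBr => le.
rewrite kE -(ler_pM2l h0) [leRHS]mulrA; apply: le_trans le.
rewrite [leLHS](_ : _ = omega m.+1 * (m.+1%:R * r ^+ m * h)); last by ring.
by rewrite ler_wpM2l ?omega_ge0// lerBrDl bernoulli_expr// ltW.
Qed.

(** A set of measure zero would have a cone of volume zero, but the cone contains a
    dilate of the ball [eball w e]. *)
Lemma hausdorff_gt0 A (x0 w : 'rV[R]_m.+1) r e : 0 < r -> 0 < e -> w != 0 ->
  (forall a, A a -> r <= enorm (a - x0)) ->
  (forall v, eball w e v -> sees A x0 v) ->
  (0 < hausdorff m A)%E.
Proof.
move=> r0 e0 w0 Ar Asee; have wp := enorm_gt0 w0.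
rewrite lt_neqAle outer_measure_ge0 andbT; apply/eqP => H0.
have r10 : 0 < r + 1 by rewrite addr_gt0.
pose c := (r + 1) / enorm w; have c0 : 0 < c by rewrite divr_gt0.
pose d := Num.min 1 (c * e); have d0 : 0 < d by rewrite lt_min ltr01 mulr_gt0.
have := lebesgue_cone_hausdorff r0 (ltr0Sn R 1) Ar.
rewrite -H0 mule0; apply/negP; rewrite -ltNge.
apply: lt_le_trans (lebesgue_eball_gt0 (c *: w) d0) _; apply: lebesgue_le => v vd.
have {}vd : enorm (v - c *: w) < d by [].
split.
  have cw : enorm (c *: w) = r + 1 by rewrite enormZ gtr0_norm// divfK// gt_eqF.
  have vd1 : enorm (v - c *: w) < 1 by apply: lt_le_trans vd _; rewrite ge_min lexx.
  have := enormD (v - c *: w) (c *: w); rewrite subrK cw => h1.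
  have := enormD (c *: w - v) v; rewrite subrK cw enormB => h2.
  by apply/andP; split; lra.
have [|a [t [Aa t0 E]]] := Asee (c^-1 *: v).
  rewrite /eball /= (_ : _ - w = c^-1 *: (v - c *: w)); last first.
    by rewrite scalerBr scalerA mulVf ?scale1r// gt_eqF.
  rewrite enormZ gtr0_norm ?invr_gt0// mulrC ltr_pdivrMr// mulrC.
  by apply: lt_le_trans vd _; rewrite ge_min lexx orbT.
exists a, (c * t); split=> //; first exact: mulr_gt0.
by rewrite -scalerA -E scalerA divff ?scale1r// gt_eqF.
Qed.

End HausdorffLowerBounds.

(** * Closed sets are measurable for Hausdorff measures *)

Section EuclideanTopology.
Context {R : realType} {n : nat}.

Lemma open_eball (U : set 'rV[R]_n) x : open U -> U x ->
  exists2 e : R, 0 < e & eball x e `<=` U.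
Proof.
move=> oU Ux; have [e /= e0 eU] := (nbhs_ballP _ _).1 (open_nbhs_nbhs (conj oU Ux)).
exists e => // y xy; apply: eU; split=> // i j; rewrite ord1 /ball /= distrC.
by apply: le_lt_trans xy; have := ler_enorm_coord (y - x) j; rewrite !mxE.
Qed.

End EuclideanTopology.

Section MetricOuterMeasure.
Context {R : realType} {n : nat} (s : nat).
Implicit Types (A B F X : set 'rV[R]_n).
Local Notation H := (@hausdorff R n s).
Let mu : {outer_measure set 'rV[R]_n -> \bar R} := H.

Let leH A B : A `<=` B -> (H A <= H B)%E. Proof. exact: (le_outer_measure mu). Qed.

Let H_ge0 A : (0 <= H A)%E. Proof. exact: (outer_measure_ge0 mu). Qed.


Lemma hausdorff_delta_anti (d d' : R) A : d <= d' ->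
  (hausdorff_delta s d' A <= hausdorff_delta s d A)%E.
Proof.
move=> dd'; apply: ereal_inf_le_tmp => _ [U [Ud AU] <-]; exists U => //; split=> // k.
by apply: le_trans (Ud k) _; rewrite lee_fin.
Qed.

(** A set of diameter less than [e] cannot meet both [A] and [B]. *)
Lemma hausdorff_delta_separated (d e : R) A B : d < e ->
  (forall a b, A a -> B b -> e <= enorm (a - b)) ->
  (hausdorff_delta s d A + hausdorff_delta s d B <= hausdorff_delta s d (A `|` B))%E.
Proof.
move=> de AB; apply: le_ereal_inf_tmp => _ [U [Ud ABU] <-].
pose V (E : set 'rV[R]_n) k := if `[< U k `&` E !=set0 >] then U k else set0.
have VU (E : set 'rV[R]_n) : E `<=` A `|` B -> (hausdorff_delta s d E <=
    \sum_(k <oo) hausdorff_gauge s (V E k))%E.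
  move=> EAB; apply: ereal_inf_lbound; exists (V E) => //; split=> [k|x Ex].
    apply: le_trans (Ud k); rewrite /V; case: ifP => // _.
    by rewrite ediam0 ediam_ge0.
  have [k _ Uk] := ABU _ (EAB _ Ex); exists k => //; rewrite /V asboolT//.
  by exists x.
apply: le_trans (leeD (VU A _) (VU B _)) _; [by left|by right|].
rewrite -nneseriesD; last 2 first.
- by move=> k _ _; exact: hausdorff_gauge_ge0.
- by move=> k _ _; exact: hausdorff_gauge_ge0.
apply: lee_nneseries => [k _ _|k _]; first by rewrite adde_ge0 ?hausdorff_gauge_ge0.
rewrite /V; case: asboolP => [[a [Ua Aa]]|_]; case: asboolP => [[b [Ub Bb]]|_];
  rewrite ?hausdorff_gauge0 ?adde0 ?add0e ?hausdorff_gauge_ge0//.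
suff : d < d by rewrite ltxx.
apply: lt_le_trans de _; apply: le_trans (AB _ _ Aa Bb) _; rewrite -lee_fin.
by apply: le_trans (Ud k); apply: ereal_sup_ubound; right; exists a => //; exists b.
Qed.

Lemma hausdorff_separated (e : R) A B : 0 < e ->
  (forall a b, A a -> B b -> e <= enorm (a - b)) ->
  (H A + H B <= H (A `|` B))%E.
Proof.
move=> e0 AB; have [->|Too] := eqVneq (H (A `|` B)) +oo%E; first exact: leey.
have fin E : (E `<=` A `|` B) -> H E \is a fin_num.
  move=> EAB; rewrite ge0_fin_numE ?H_ge0//.
  by apply: (@le_lt_trans _ _ (H (A `|` B))); [exact: leH|rewrite ltey].
have fA := fin A (@subsetUl _ _ _); have fB := fin B (@subsetUr _ _ _).
have fAB := fin _ (@subset_refl _ (A `|` B)).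
rewrite -leeBrDr//; apply: ge_ereal_sup => _ [d1 /= d10 <-].
have fd1 : hausdorff_delta s d1 A \is a fin_num.
  rewrite ge0_fin_numE.
    apply: (@le_lt_trans _ _ (H A)); last by rewrite -ge0_fin_numE ?H_ge0.
    exact: hausdorff_delta_le_hausdorff.
  rewrite (hausdorff_deltaE _ (NngNum (ltW d10))) mu_ext_ge0// => U.
  exact: hausdorff_gauge_ge0.
rewrite leeBrDr// addeC -leeBrDr//; apply: ge_ereal_sup => _ [d2 /= d20 <-].
rewrite leeBrDr// addeC.
pose d := Num.min (Num.min d1 d2) (e / 2).
have d0 : 0 < d by rewrite !lt_min d10 d20 divr_gt0.
have de : d < e by rewrite gt_min ltr_pdivrMr// ltr_pMr// ltr1n orbT.
apply: (@le_trans _ _ (H (A `|` B)%classic)); last by [].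
apply: (@le_trans _ _ (hausdorff_delta s d A + hausdorff_delta s d B)%E).
  by apply: leeD; apply: hausdorff_delta_anti; rewrite /d !ge_min lexx ?orbT.
apply: le_trans (hausdorff_delta_separated de AB) _.
by apply: ereal_sup_ubound; exists d.
Qed.

(** Caratheodory's criterion: the points of [X] off [F] are exhausted by those at
    distance at least [c k] from [F], because the successive layers [L k] are
    pairwise separated unless they are adjacent, so that their areas are summable. *)
Lemma hausdorff_closed_split F X : closed F ->
  (H (X `&` F) + H (X `&` ~` F) <= H X)%E.
Proof.
move=> cF; have [->|Xoo] := eqVneq (H X) +oo%E; first exact: leey.
pose A := X `&` ~` F.
pose c k : R := k.+1%:R^-1.
have c0 k : 0 < c k by rewrite invr_gt0.
have cS k : c k.+1 < c k by rewrite ltf_pV2 ?posrE// ltr_nat.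
pose D k := [set x | A x /\ forall y, F y -> c k <= enorm (x - y)].
pose L k := D k.+1 `\` D k.
have DX k : D k `<=` X by move=> x [[]].
have DS k : D k `<=` D k.+1.
  by move=> x [Ax xF]; split=> // y /xF; apply: le_trans; exact: ltW.
have sep k : (H (D k) + H (L k.+1) <= H (D k.+2))%E.
  apply: (@le_trans _ _ (H (D k `|` L k.+1))).
    apply: (@hausdorff_separated (c k - c k.+1)); first by rewrite subr_gt0.
    move=> x y [_ xF] [[Ay _] nDy].
    have [v [Fv yv]] : exists v, F v /\ enorm (y - v) < c k.+1.
      apply: contrapT => /forallNP nv; apply: nDy; split=> // v Fv.
      by rewrite leNgt; apply/negP => yv; apply: (nv v).
    have := xF _ Fv; have := enorm_dist x y v; lra.
  by apply: leH => x [/DS/DS//|[]].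
have partial N : (\sum_(0 <= j < N) H (L j.+1) <= H (D N) + H (D N.+1))%E.
  elim: N => [|N IH]; first by rewrite big_geq// adde_ge0 ?H_ge0.
  rewrite big_nat_recr//=; apply: le_trans (leeD2r _ IH) _.
  by rewrite addeAC addeC leeD2l// sep.
have Xfin : H X \is a fin_num by rewrite ge0_fin_numE ?H_ge0 ?ltey.
have Lsum : (\sum_(j <oo) H (L j.+1) < +oo)%E.
  apply: (@le_lt_trans _ _ (H X + H X)%E); last by rewrite -(fineK Xfin) -EFinD ltry.
  apply: lime_le; first by apply: is_cvg_nneseries => *; exact: H_ge0.
  apply: nearW => N; apply: le_trans (partial N) _.
  by apply: leeD; exact: leH.
have tail0 := nneseries_tail_cvg Lsum (fun k _ => H_ge0 _).
apply/lee_addgt0Pr => e e0.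
have [k ke] : exists k, (\sum_(k <= j <oo) H (L j.+1) <= e%:E)%E.
  have /fine_cvgP[[N1 _ fN] /cvgrPdist_lt/(_ _ e0)[N2 _ ltN]] := tail0.
  exists (maxn N1 N2); have := ltN (maxn N1 N2) (leq_maxr _ _).
  have fk := fN (maxn N1 N2) (leq_maxl _ _).
  rewrite /= sub0r normrN => /ltW/(le_trans (ler_norm _)).
  by rewrite -lee_fin fineK.
have AE : A `<=` D k.+1 `|` \bigcup_j L (j + k).+1.
  move=> x Ax.
  have [K DK] : exists K, D K x.
    have [d d0 dF] := open_eball (closed_openC cF) Ax.2.
    exists (Num.truncn d^-1); split=> // y Fy; rewrite leNgt; apply/negP => xy.
    have /dF : eball x d y; last by [].
    rewrite /eball /= enormB; apply: lt_trans xy _.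
    rewrite /c invf_plt ?posrE//.
    have /truncn_itv/andP[_ //] : 0 <= d^-1 by rewrite invr_ge0; exact: ltW.
  have exK : exists K, `[< D K x >] by exists K; apply/asboolP.
  case: (ex_minnP exK) => {DK exK}K /asboolP DK Kmin.
  have DM i j : (i <= j)%N -> D i `<=` D j.
    move=> /subnK <-; elim: (j - i)%N => // l IH; rewrite addSn.
    by apply: subset_trans (DS _).
  have [Kk|Kk] := leqP K k.+1; first by left; exact: DM Kk _ DK.
  right; exists (K - k.+2)%N => //.
  have -> : (K - k.+2 + k)%N.+1 = K.-1 by lia.
  split; first by rewrite prednK//; lia.
  by move=> /asboolP/Kmin; lia.
have HA : (H A <= H (D k.+1) + e%:E)%E.
  apply: le_trans (leH AE) _; apply: le_trans (outer_measureU2 mu _ _) _.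
  apply: leeD2l; apply: le_trans (outer_measure_sigma_subadditive mu _) _.
  by rewrite (nneseries_addn (f := fun j => H (L j.+1))).
apply: le_trans (leeD2l _ HA) _; rewrite addeA leeD2r//.
apply: (@le_trans _ _ (H ((X `&` F) `|` D k.+1))); last first.
  by apply: leH => x [[]|/DX].
apply: (@hausdorff_separated (c k.+1)) => // x y [_ Fx] [_ yF].
by rewrite enormB; exact: yF.
Qed.

Lemma closed_caratheodory F : closed F -> mu.-caratheodory F.
Proof.
move=> cF; apply: le_caratheodory_measurable => X; exact: hausdorff_closed_split.
Qed.

End MetricOuterMeasure.

(** * Harmonicity of the Poisson kernel *)

Section PoissonKernel.
Context {R : realType} {n : nat}.
Implicit Types (x y a c v : 'rV[R]_n).

(** Reduces directional derivatives to the calculus of functions of one variable. *)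
Lemma is_derive_line (f : 'rV[R]_n -> R) x v (d : R) :
  is_derive (0 : R) 1 (fun h : R => f (h *: v + x)) d <-> is_derive x v f d.
Proof.
have E : 'D_1 (fun h : R => f (h *: v + x)) 0 = 'D_v f x.
  rewrite /derive; set g1 := fun h => h^-1 *: _; set g2 := fun h => h^-1 *: _.
  suff -> : g1 = g2 by [].
  by apply/funext => h; rewrite /g1 /g2 /= addr0 scale0r add0r [_%:A]mulr1.
split=> -[fd <-]; split; rewrite ?E//; first exact: (derivable1P f x v).2.
exact: (derivable1P f x v).1.
Qed.

Lemma is_derive_comp1 (f : 'rV[R]_n -> R) (phi : R -> R) x v (d e : R) :
  is_derive x v f d -> is_derive (f x) 1 phi e ->
  is_derive x v (fun y => phi (f y)) (e * d).
Proof.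
move=> /is_derive_line fd phie; apply/is_derive_line.
by apply: (@is_derive1_comp _ phi (fun h : R => f (h *: v + x))); rewrite scale0r add0r.
Qed.

Lemma is_derive_quadratic (f : 'rV[R]_n -> R) x v (d k : R) :
  (forall h, f (h *: v + x) = f x + h * d + h ^+ 2 * k) -> is_derive x v f d.
Proof.
move=> fE.
have cv : (fun h => h^-1 *: ((f \o shift x) (h *: v) - f x)) @ 0^' --> d.
  have c0 : (fun h : R => d + h * k) @ 0^' --> d.
    apply: cvg_within_filter.
    suff : (fun h : R => d + h * k) @ (0 : R) --> d + 0 * k by rewrite mul0r addr0.
    apply: cvgD; first exact: cvg_cst.
    by apply: cvgM; [exact: cvg_id|exact: cvg_cst].
  apply: cvg_trans c0; apply: near_eq_cvg.
  have h0 : \forall h \near 0^', h != 0 :> R by exact: nbhs_dnbhs_neq.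
  apply: filterS h0 => h h0.
  rewrite /= fE (_ : _ - f x = h * (d + h * k)); last by ring.
  by rewrite /GRing.scale/= mulKf.
by apply: DeriveDef; [apply: cvgP cv|apply: cvg_lim cv].
Qed.

Lemma dot_delta j y : dot (delta_mx 0 j) y = y 0 j.
Proof.
rewrite /dot (bigD1 j)//= big1 => [|i /negbTE ij]; rewrite mxE ?eqxx ?ij/=.
  by rewrite mul1r addr0.
by rewrite mul0r.
Qed.

Lemma is_derive_coord x c i j :
  is_derive x (delta_mx 0 j) (fun y => y 0 i - c 0 i) (i == j)%:R.
Proof.
apply: (@is_derive_quadratic _ _ _ _ 0) => h.
by rewrite !mxE eqxx/=; ring.
Qed.

Lemma is_derive_sqdist x c j :
  is_derive x (delta_mx 0 j) (fun y => dot (y - c) (y - c)) (2 * (x 0 j - c 0 j)).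
Proof.
apply: (@is_derive_quadratic _ _ _ _ 1) => h.
have -> : x 0 j - c 0 j = (x - c) 0 j by rewrite !mxE.
rewrite -addrA; move: (x - c) => y.
by rewrite !dotE (dotC y) !dot_delta mxE !eqxx/=; ring.
Qed.

Definition invpow a k x : R := (enorm (x - a) ^+ k)^-1.

Lemma is_derive_invpow x a j k : x != a ->
  is_derive x (delta_mx 0 j) (invpow a k) (- (k%:R * (x 0 j - a 0 j) * invpow a k.+2 x)).
Proof.
move=> xa; have N0 : 0 < enorm (x - a) by rewrite enorm_gt0// subr_eq0.
have q0 : 0 < dot (x - a) (x - a) by rewrite -sqr_enorm exprn_gt0.
have Nk0 : enorm (x - a) ^+ k != 0 by rewrite expf_neq0// gt_eqF.
pose N y := enorm (y - a).
have dN : is_derive x (delta_mx 0 j) N ((x 0 j - a 0 j) / N x).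
  apply: is_derive_eq.
    exact: (is_derive_comp1 (is_derive_sqdist x a j) (is_derive1_sqrt q0)).
  by rewrite -/(enorm (x - a)) -/(N x); field; rewrite gt_eqF.
have : is_derive x (delta_mx 0 j) (fun y => N y ^+ k)
    (k%:R * N x ^+ k.-1 * ((x 0 j - a 0 j) / N x)).
  rewrite (_ : (fun y => _) = N ^+ k); first exact: is_deriveX.
  by apply/funext => y; rewrite exprfctE.
move=> [dd dv]; split; first exact: derivableV.
rewrite deriveV// dv /invpow -/(N x) /GRing.scale/=.
case: k {Nk0 dd dv} => [|k]; first by rewrite !mul0r mulr0 oppr0.
by rewrite /= !exprS; field; rewrite ?expf_neq0 gt_eqF.
Qed.

Lemma is_derive_add (f g : 'rV[R]_n -> R) x v (df dg : R) :
  is_derive x v f df -> is_derive x v g dg ->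
  is_derive x v (fun y => f y + g y) (df + dg).
Proof. exact: is_deriveD. Qed.

Lemma is_derive_opp (f : 'rV[R]_n -> R) x v (df : R) :
  is_derive x v f df -> is_derive x v (fun y => - f y) (- df).
Proof. exact: is_deriveN. Qed.

Lemma is_derive_mul (f g : 'rV[R]_n -> R) x v (df dg : R) :
  is_derive x v f df -> is_derive x v g dg ->
  is_derive x v (fun y => f y * g y) (f x * dg + g x * df).
Proof. exact: is_deriveM. Qed.

Lemma is_derive_scale (f : 'rV[R]_n -> R) x v (c df : R) :
  is_derive x v f df -> is_derive x v (fun y => c * f y) (c * df).
Proof. exact: is_deriveZ. Qed.

Lemma continuous_sub (f g : 'rV[R]_n -> R) x : {for x, continuous f} ->
  {for x, continuous g} -> {for x, continuous (fun y => f y - g y)}.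
Proof. by move=> cf cg; exact: (@cvgB _ R^o _ (nbhs x) _ f g). Qed.

Lemma continuous_mul (f g : 'rV[R]_n -> R) x : {for x, continuous f} ->
  {for x, continuous g} -> {for x, continuous (fun y => f y * g y)}.
Proof. by move=> cf cg; exact: (@cvgM R _ (nbhs x) _ f g). Qed.

Lemma continuous_const (c : R) x : {for x, continuous (fun=> c : R)}.
Proof. exact: (@cvg_cst _ c _ (nbhs x)). Qed.

Lemma continuous_coordB c i x : {for x, continuous (fun y : 'rV[R]_n => y 0 i - c 0 i)}.
Proof.
by apply: continuous_sub; [exact: coord_continuous|exact: continuous_const].
Qed.

Lemma continuous_sqdist c x :
  {for x, continuous (fun y : 'rV[R]_n => dot (y - c) (y - c))}.
Proof.
apply: (@cvg_big _ _ +%R 0 xpredT _ _ (nbhs x)) => [|i _]; first exact: add_continuous.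
rewrite (_ : (fun y : 'rV[R]_n => _) =
    (fun y : 'rV[R]_n => (y 0 i - c 0 i) * (y 0 i - c 0 i))).
  rewrite !mxE; apply: (@continuous_mul (fun y => y 0 i - c 0 i) (fun y => y 0 i - c 0 i));
    exact: continuous_coordB.
by apply/funext => y; rewrite !mxE.
Qed.

Lemma continuous_enormB c : continuous (fun x : 'rV[R]_n => enorm (x - c)).
Proof.
move=> x.
apply: (@continuous_comp _ _ _ (fun y : 'rV[R]_n => dot (y - c) (y - c)) Num.sqrt).
  exact: continuous_sqdist.
exact: sqrt_continuous.
Qed.

Lemma continuous_invpow a k x : x != a -> {for x, continuous (invpow a k)}.
Proof.
move=> xa; apply: (@continuousV _ _ (fun y : 'rV[R]_n => enorm (y - a) ^+ k)).
  by rewrite expf_neq0// gt_eqF// enorm_gt0// subr_eq0.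
apply: (@continuous_comp _ _ _ (fun y : 'rV[R]_n => enorm (y - a)) (fun u => u ^+ k)).
  exact: continuous_enormB.
exact: exprn_continuous.
Qed.

(** Up to a constant factor, the Poisson kernel with pole [a] of the ball centred at [c]
    whose boundary contains [a]. *)
Definition poisson a c x : R :=
  (dot (a - c) (a - c) - dot (x - c) (x - c)) * invpow a n x.

Let A a c x : R := dot (a - c) (a - c) - dot (x - c) (x - c).

Let poisson1 a c i x : R :=
  - (n%:R * (A a c x * ((x 0 i - a 0 i) * invpow a n.+2 x))) -
  2 * ((x 0 i - c 0 i) * invpow a n x).

Let poisson2 a c i j x : R :=
  - (n%:R * (A a c x * ((i == j)%:R * invpow a n.+2 x -
       (x 0 i - a 0 i) * (n.+2%:R * (x 0 j - a 0 j) * invpow a n.+4 x)) -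
     2 * (x 0 j - c 0 j) * ((x 0 i - a 0 i) * invpow a n.+2 x))) -
  2 * ((i == j)%:R * invpow a n x -
       (x 0 i - c 0 i) * (n%:R * (x 0 j - a 0 j) * invpow a n.+2 x)).

Let is_derive_A a c x j : is_derive x (delta_mx 0 j) (A a c) (- (2 * (x 0 j - c 0 j))).
Proof.
have h := is_derive_add (is_derive_cst (dot (a - c) (a - c) : R) x (delta_mx 0 j))
  (is_derive_opp (is_derive_sqdist x c j)).
by apply: (is_derive_eq h); rewrite add0r.
Qed.

Let is_derive_poisson a c i x : x != a ->
  is_derive x (delta_mx 0 i) (poisson a c) (poisson1 a c i x).
Proof.
move=> xa.
have h := is_derive_mul (is_derive_A a c x i) (is_derive_invpow i n xa).
by apply: (is_derive_eq h); rewrite /poisson1 /A; ring.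
Qed.

Let is_derive_poisson1 a c i j x : x != a ->
  is_derive x (delta_mx 0 j) (poisson1 a c i) (poisson2 a c i j x).
Proof.
move=> xa.
have h1 := is_derive_mul (is_derive_coord x a i j) (is_derive_invpow j n.+2 xa).
have h2 := is_derive_opp (is_derive_scale n%:R (is_derive_mul (is_derive_A a c x j) h1)).
have h3 := is_derive_mul (is_derive_coord x c i j) (is_derive_invpow j n xa).
have h := is_derive_add h2 (is_derive_opp (is_derive_scale 2 h3)).
by apply: (is_derive_eq h); rewrite /poisson2; ring.
Qed.

Lemma near_neq a x : x != a -> \forall y \near x, y != a.
Proof.
move=> xa; have /open_nbhs_nbhs : open_nbhs x [set y : 'rV[R]_n | enorm (y - a) != 0].
  split; last by rewrite /= gt_eqF// enorm_gt0// subr_eq0.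
  have := @open_comp _ _ (fun y : 'rV[R]_n => enorm (y - a)) [set u : R | u != 0] _
    (@open_neq R 0).
  by apply=> y _; exact: continuous_enormB.
apply: filterS => y /=; apply: contra_neq => ->; by rewrite subrr enorm0.
Qed.

Let continuous_near (f g : 'rV[R]_n -> R) x : (\forall y \near x, f y = g y) ->
  {for x, continuous g} -> {for x, continuous f}.
Proof.
move=> fg cg; have fgx : f x = g x by exact: nbhs_singleton fg.
rewrite /prop_for /continuous_at fgx; apply: cvg_trans cg.
have gf : \forall y \near x, g y = f y by apply: filterS fg => y ->.
exact: (@near_eq_cvg _ _ (nbhs x) _ _ _ gf).
Qed.

Let partial_poisson a c i x : x != a -> partial (poisson a c) i x = poisson1 a c i x.
Proof. by move=> xa; have [_] := is_derive_poisson c i xa. Qed.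

Let near_partial a c i x : x != a ->
  \forall y \near x, partial (poisson a c) i y = poisson1 a c i y.
Proof. by move=> /near_neq; apply: filterS => y /(partial_poisson c i). Qed.

Let is_derive_partial a c i j x : x != a ->
  is_derive x (delta_mx 0 j) (partial (poisson a c) i) (poisson2 a c i j x).
Proof.
move=> xa; apply: near_eq_is_derive (is_derive_poisson1 c i j xa).
by apply: filterS (near_partial c i xa) => y ->.
Qed.

Let partial2_poisson a c i j x : x != a ->
  partial (partial (poisson a c) i) j x = poisson2 a c i j x.
Proof. by move=> xa; have [_] := is_derive_partial c i j xa. Qed.

Let continuous_A a c x : {for x, continuous (A a c)}.
Proof.
apply: (@continuous_sub (fun=> dot (a - c) (a - c)) (fun y => dot (y - c) (y - c))).
  exact: continuous_const.
exact: continuous_sqdist.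
Qed.

Lemma continuous_poisson a c x : x != a -> {for x, continuous (poisson a c)}.
Proof.
move=> xa; exact: (@continuous_mul (A a c) (invpow a n) x (@continuous_A a c x)
  (@continuous_invpow a n x xa)).
Qed.

Let continuous_scale (k : R) (f : 'rV[R]_n -> R) x : {for x, continuous f} ->
  {for x, continuous (fun y => k * f y)}.
Proof.
by move=> cf; exact: (@continuous_mul (fun=> k) f x (@continuous_const k x) cf).
Qed.

Let continuous_opp (f : 'rV[R]_n -> R) x : {for x, continuous f} ->
  {for x, continuous (fun y => - f y)}.
Proof. exact: (@continuousN _ R^o). Qed.

Let continuous_poisson1 a c i x : x != a -> {for x, continuous (poisson1 a c i)}.
Proof.
move=> xa; apply: continuous_sub.
  apply: continuous_opp; apply: continuous_scale; apply: continuous_mul.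
    exact: continuous_A.
  by apply: continuous_mul; [exact: continuous_coordB|exact: continuous_invpow].
apply: continuous_scale.
by apply: continuous_mul; [exact: continuous_coordB|exact: continuous_invpow].
Qed.

Let continuous_poisson2 a c i j x : x != a -> {for x, continuous (poisson2 a c i j)}.
Proof.
move=> xa.
have w k := @continuous_invpow a k x xa.
have y k := @continuous_coordB a k x.
have z k := @continuous_coordB c k x.
have yw l k (q : R) : {for x, continuous (fun v => q * (v 0 k - a 0 k) * invpow a l v)}.
  by apply: continuous_mul; [exact: continuous_scale|exact: w].
apply: continuous_sub.
  apply: continuous_opp; apply: continuous_scale; apply: continuous_sub.
    apply: continuous_mul; first exact: continuous_A.
    apply: continuous_sub; first by apply: continuous_scale; exact: w.
    by apply: continuous_mul; [exact: y|exact: yw].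
  apply: continuous_mul; first by apply: continuous_scale; exact: z.
  by apply: continuous_mul; [exact: y|exact: w].
apply: continuous_scale; apply: continuous_sub; first by apply: continuous_scale; exact: w.
by apply: continuous_mul; [exact: z|exact: yw].
Qed.

Lemma poisson_harmonic (Omega : set 'rV[R]_n) a c :
  ~ Omega a -> harmonic_on Omega (poisson a c).
Proof.
move=> aO; have neq x : Omega x -> x != a.
  by move=> Ox; apply/eqP => xa; apply: aO; rewrite -xa.
split=> x /neq xa.
  split; first exact: continuous_poisson.
  move=> i; split; first by have [] := is_derive_poisson c i xa.
  split.
    by apply: continuous_near (@continuous_poisson1 a c i x xa); exact: near_partial.
  move=> j; split; first by have [] := is_derive_partial c i j xa.
  apply: continuous_near (@continuous_poisson2 a c i j x xa).
  by apply: filterS (near_neq xa) => y /(partial2_poisson c i j).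
rewrite /laplacian; under eq_bigr do rewrite partial2_poisson//.
have N0 : enorm (x - a) != 0 by rewrite gt_eqF// enorm_gt0// subr_eq0.
(* All terms are multiples of one power of the distance to the pole: [wn] and [w4]
   change the exponents, and [AE] is the law of cosines. *)
pose q := dot (x - a) (x - a); pose s := dot (x - c) (x - a).
have qE : q = enorm (x - a) ^+ 2 by rewrite sqr_enorm.
have wn : invpow a n x = q * invpow a n.+2 x.
  by rewrite qE /invpow !exprS; field; rewrite expf_neq0// N0.
have w4 : q * invpow a n.+4 x = invpow a n.+2 x.
  by rewrite qE /invpow !exprS; field; rewrite expf_neq0// N0.
have AE : A a c x = q - 2 * s.
  rewrite /A /q /s (_ : a - c = (x - c) - (x - a)).
    by move: (x - c) (x - a) => u v; rewrite !dotE (dotC v u); ring.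
  by apply/rowP => i; rewrite !mxE; ring.
pose al := - (n%:R * (A a c x * invpow a n.+2 x)) - 2 * invpow a n x.
pose be := n%:R * (A a c x * (n.+2%:R * invpow a n.+4 x)).
pose ga := 4 * (n%:R * invpow a n.+2 x).
rewrite (eq_bigr (fun i : 'I_n => al + be * ((x - a) 0 i * (x - a) 0 i) +
    ga * ((x - c) 0 i * (x - a) 0 i))); last first.
  by move=> i _; rewrite /poisson2 eqxx !mxE /al /be /ga /=; ring.
rewrite 2!big_split/= -2!mulr_sumr sumr_const card_ord -[al *+ n]mulr_natl.
rewrite -/(dot (x - a) (x - a)) -/(dot (x - c) (x - a)) -/q -/s /al /be /ga wn AE.
transitivity (n%:R * (q - 2 * s) * (n.+2%:R * (q * invpow a n.+4 x) -
  (n%:R + 2) * invpow a n.+2 x)); first by ring.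
by rewrite w4 -[n.+2%:R]natr1 -[n.+1%:R]natr1; ring.
Qed.

End PoissonKernel.

(** * Integrals over the boundary *)

Section IntegralComparison.
Context d (T : measurableType d) (R : realType) (mu : {measure set T -> \bar R}).
Implicit Types (K B D : set T) (f p : T -> R).

Lemma bounded_on K f (C : R) : (forall x, K x -> `|f x| <= C) -> [bounded f x | x in K].
Proof.
move=> fC; exists C; split; first exact: num_real.
by move=> y /ltW Cy x /fC; move=> /le_trans; apply.
Qed.

(** Integrates the pointwise bound of [p] by [2 * f] on [B] plus the constant [eps]
    minus [kap] times the indicator function of [D]. *)
Lemma integral_upper_split K B D p f (C eps kap : R) :
  measurable K -> measurable B -> measurable D -> (mu K < +oo)%E ->
  measurable_fun K p -> (forall x, K x -> `|p x| <= C) ->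
  measurable_fun K f -> (forall x, K x -> `|f x| <= C) ->
  D `<=` K -> (forall x, D x -> ~ B x) ->
  (forall x, K x -> B x -> p x <= 2 * f x + eps) ->
  (forall x, K x -> ~ B x -> p x <= eps) ->
  (forall x, D x -> p x <= eps - kap) ->
  (\int[mu]_(x in K) (p x)%:E + kap%:E * mu D <=
   2%:E * \int[mu]_(x in K `&` B) (f x)%:E + eps%:E * mu K)%E.
Proof.
move=> mK mB mD Koo mp pC mf fC DK DB pB pnB pD.
pose F x := f x * \1_B x.
have Kfin : mu K \is a fin_num by rewrite ge0_fin_numE.
have Dfin : mu D \is a fin_num.
  by rewrite ge0_fin_numE// (le_lt_trans _ Koo)// le_measure ?inE.
have ip : mu.-integrable K (EFin \o p).
  by apply: measurable_bounded_integrable => //; exact: bounded_on pC.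
have iF : mu.-integrable K (EFin \o F).
  apply: measurable_bounded_integrable => //.
    by apply: measurable_funM => //; exact: measurable_indic.
  apply: (@bounded_on _ _ `|C|) => x Kx; rewrite /F indicE; case: (_ \in _).
    by rewrite mulr1 (le_trans (fC x Kx))// ler_norm.
  by rewrite mulr0 normr0.
have iD : mu.-integrable K (EFin \o (fun x => kap * \1_D x)).
  apply: measurable_bounded_integrable => //.
    by apply: measurable_funM => //; exact: measurable_indic.
  apply: (@bounded_on _ _ `|kap|) => x Kx; rewrite indicE; case: (_ \in _).
    by rewrite mulr1.
  by rewrite mulr0 normr0.
have ie : mu.-integrable K (EFin \o (fun=> eps)).
  by apply: measurable_bounded_integrable => //; exact: (@bounded_on _ _ `|eps|).
have iF2 : mu.-integrable K (fun x => 2%:E * (F x)%:E)%E by exact: integrableZl.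
have ied : mu.-integrable K (fun x => eps%:E - (kap * \1_D x)%:E)%E.
  exact: (@integrableB _ _ _ mu K mK (EFin \o (fun=> eps))).
have -> : (\int[mu]_(x in K `&` B) (f x)%:E = \int[mu]_(x in K) (F x)%:E)%E.
  rewrite integral_mkcondr; apply: eq_integral => x _.
  by rewrite patchE /F indicE; case: (_ \in _); rewrite ?mulr1 ?mulr0.
have le : (\int[mu]_(x in K) (p x)%:E <=
    \int[mu]_(x in K) (2%:E * (F x)%:E + (eps%:E - (kap * \1_D x)%:E)))%E.
  apply: le_integral => //; first exact: integrableD.
  move=> x /set_mem Kx; rewrite -EFinM -EFinB -EFinD lee_fin /F !indicE.
  have [xD|xD] := boolP (x \in D).
    have xB : (x \in B) = false by apply/memNset/DB/set_mem.
    by rewrite xB mulr0 mulr0 add0r mulr1; apply/pD/set_mem.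
  rewrite mulr0 subr0; have [xB|xB] := boolP (x \in B).
    by rewrite mulr1; apply: pB => //; exact: set_mem.
  by rewrite !mulr0 add0r; apply: pnB => // Bx; rewrite mem_set in xB.
move: le; rewrite integralD// integralZl// integralB_EFin//.
rewrite integral_cst//=.
have -> : (\int[mu]_(x in K) (kap * \1_D x)%:E = kap%:E * mu D)%E.
  under eq_integral do rewrite EFinM.
  rewrite integralZl//; last first.
    apply: measurable_bounded_integrable => //.
    apply: (@bounded_on _ _ 1) => x Kx; rewrite indicE; case: (_ \in _).
      by rewrite normr1.
    by rewrite normr0.
  by rewrite integral_indic// setIidl.
by rewrite addeA leeBrDr// fin_numM.
Qed.

End IntegralComparison.

Section HausdorffIntegral.
Context {R : realType} {n : nat}.
Local Notation T := (caratheodory_type (@hausdorff R n n.-1)).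

Lemma closed_sigma_measurable (F : set 'rV[R]_n) : closed F -> measurable (F : set T).
Proof. exact: closed_caratheodory. Qed.

Lemma continuous_sigma_measurable (K : set 'rV[R]_n) (f : 'rV[R]_n -> R) :
  closed K -> (forall x, K x -> {for x, continuous f}) ->
  measurable_fun (K : set T) (f : T -> R).
Proof.
move=> cK cf mK; apply: (measurability _ (RGenCInfty.measurableE R)) => //.
move=> _ [_ [a ->] <-]; apply: closed_sigma_measurable => x clx.
have Kx : K x by apply: cK; apply: closure_subset clx; exact: subIsetl.
split=> //=; rewrite in_itv/= andbT leNgt; apply/negP => fxa.
have /clx [y [[_ /=]]] : nbhs x [set y | f y < a].
  exact: (cf x Kx _ (lt_nbhsl fxa)).
by rewrite in_itv/= andbT leNgt => /negP.
Qed.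

End HausdorffIntegral.

(** * Euclidean balls and limits inferior *)

Lemma limf_einf_lt (T : choiceType) (X : filteredType T) (R : realType)
    (f : X -> \bar R) (F : set (set X)) (c : \bar R) (V : set X) :
  (limf_einf f F < c)%E -> F V -> exists2 v, V v & (f v < c)%E.
Proof.
rewrite limf_einfE => lt FV.
have : (ereal_inf (f @` V) < c)%E.
  by apply: le_lt_trans lt; apply: ereal_sup_ubound; exists V.
by move=> /ereal_inf_lt[_ [v Vv <-] fv]; exists v.
Qed.

Section Geometry.
Context {R : realType} {n : nat}.
Implicit Types (x y z c : 'rV[R]_n) (Omega : set 'rV[R]_n).

Lemma nbhs_eball x (e : R) : 0 < e -> nbhs x (eball x e).
Proof.
move=> e0; apply: (@continuous_enormB R n x x _ (lt_nbhsl _)).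
by rewrite subrr enorm0.
Qed.

Lemma open_eball_set x (e : R) : open (eball x e).
Proof.
apply: (@open_comp _ _ (fun y : 'rV[R]_n => enorm (y - x)) [set u : R | u < e]).
  by move=> y _; exact: continuous_enormB.
exact: open_lt.
Qed.

Lemma closed_enorm_le x (e : R) : closed [set y | enorm (y - x) <= e].
Proof.
apply: (@closed_comp _ _ (fun y : 'rV[R]_n => enorm (y - x)) [set u : R | u <= e]).
  by move=> y _; exact: continuous_enormB.
exact: closed_le.
Qed.

Lemma closed_enorm_ge x (e : R) : closed [set y | e <= enorm (y - x)].
Proof.
apply: (@closed_comp _ _ (fun y : 'rV[R]_n => enorm (y - x)) [set u : R | e <= u]).
  by move=> y _; exact: continuous_enormB.
exact: closed_ge.
Qed.

Lemma closed_boundary Omega : open Omega -> closed (boundary Omega).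
Proof.
move=> oO; rewrite /boundary setDE; apply: closedI; first exact: closed_closure.
by apply: open_closedC; exact: open_interior.
Qed.

Lemma bounded_enorm Omega c : bounded_set Omega ->
  exists2 L : R, 0 < L & forall x, closure Omega x -> enorm (x - c) <= L.
Proof.
move=> [M [_ OM]]; pose L := n%:R * (`|M| + 1) + enorm c + 1.
have M1 : M < `|M| + 1 by rewrite (le_lt_trans (ler_norm M))// ltrDl.
exists L; first by rewrite ltr_wpDl// addr_ge0 ?enorm_ge0// mulr_ge0// addr_ge0.
suff : closure Omega `<=` [set y | enorm (y - c) <= L] by [].
rewrite closureE; apply: smallest_sub; first exact: closed_enorm_le.
move=> x Ox /=; apply: le_trans (enormD _ _) _; rewrite enormN.
apply: (@le_trans _ _ (n%:R * (`|M| + 1) + enorm c)); last by rewrite lerDl.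
rewrite lerD2r; apply: enorm_ler_coord => i.
apply: le_trans (OM _ M1 x Ox); rewrite /Num.norm/= mx_normrE.
exact: (le_bigmax _ (fun ij => `|x ij.1 ij.2|) (0, i)).
Qed.

End Geometry.

(** * The mean value property with a pole near the touching point *)

Section PseudosphereEstimate.
Context {R : realType} {n : nat}.
Implicit Types (x y z a c : 'rV[R]_n) (Omega : set 'rV[R]_n).

Lemma flatness_le1_approx Omega (x0 z : 'rV[R]_n) :
  (0 < n)%N -> x0 != z -> (spherical_flatness Omega x0 z <= 1)%E ->
  forall e rho0 : R, 0 < e -> 0 < rho0 -> exists2 rho : R, 0 < rho < rho0 &
  forall eta : R, 0 < eta -> exists a, [/\ ~ closure Omega a, enorm (a - z) < eta &
    (flatness_integral Omega x0 z rho a <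
     (n%:R * omega n * enorm (z - x0) / 2 + e)%:E)%E].
Proof.
move=> n0 x0z S1 e rho0 e0 rho00.
have c0 : 0 < n%:R * omega n * enorm (z - x0).
  by rewrite !mulr_gt0 ?ltr0n ?omega_gt0// enorm_gt0// subr_eq0 eq_sym.
move: S1; rewrite /spherical_flatness.
set c := n%:R * omega n * enorm (z - x0) in c0 *; set L := limf_einf _ _ => S1.
have Lc : (L < (c / 2 + e)%:E)%E.
  apply: (@le_lt_trans _ _ (c / 2)%:E); last by rewrite lte_fin ltrDl.
  move: S1; rewrite muleC -lee_pdivlMr ?divr_gt0// mul1e.
  by rewrite invf_div.
have [|rho /= rhoV Grho] := limf_einf_lt (V := [set rho | 0 < rho < rho0]) Lc.
  near=> rho; apply/andP; split; near: rho; [exact: nbhs_right_gt|exact: nbhs_right_lt].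
exists rho => // eta eta0.
have [|a [az aO] aF] := limf_einf_lt (V := eball z eta `&` ~` closure Omega) Grho.
  by apply: filterS (nbhs_eball z eta0) => y yz nO.
by exists a.
Unshelve. all: by end_near. Qed.

(** The flatness integrand is half the sum of the Poisson kernel and of the positive
    function [|x - a| ^ (2 - n)]; hence twice the integrand bounds the kernel from above
    near [z], where the kernel itself is not under control. *)
Lemma flatness_integrandE a c x :
  2 * (dot (a - x) (a - c) / enorm (x - a) ^+ n) =
  dot (x - a) (x - a) * invpow a n x + poisson a c x.
Proof.
rewrite /poisson -mulrDl mulrA; congr (_ * _).
rewrite (_ : x - c = (a - c) - (a - x)); last by apply/rowP => i; rewrite !mxE; ring.
rewrite -(opprB a x); move: (a - x) (a - c) => u v.
by rewrite !dotE (dotC v u); ring.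
Qed.

Lemma poisson_center a c : (1 < n)%N -> a != c ->
  poisson a c c = (enorm (a - c) ^+ (n - 2))^-1.
Proof.
move=> n1 ac; rewrite /poisson /invpow subrr -!sqr_enorm enorm0 expr0n subr0 enormB.
have N0 : enorm (c - a) != 0 by rewrite gt_eqF// enorm_gt0// subr_eq0 eq_sym.
move: (enorm _) N0 => N N0; rewrite -{1}(subnK n1) exprD; field.
by rewrite N0 expf_neq0.
Qed.

Section Estimate.
Variables (Omega : set 'rV[R]_n) (x0 z : 'rV[R]_n) (delta : R).
Hypotheses (n1 : (1 < n)%N) (oO : open Omega) (bO : bounded_set Omega)
  (Koo : (sigma (boundary Omega) < +oo)%E) (Ox0 : Omega x0)
  (pO : harmonic_pseudosphere Omega x0) (x0z : x0 != z)
  (Kr : forall x, boundary Omega x -> enorm (z - x0) <= enorm (x - x0))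
  (S1 : (spherical_flatness Omega x0 z <= 1)%E) (delta0 : 0 < delta).

Let K := boundary Omega.
Let r := enorm (z - x0).
Let far := K `&` [set x | r + delta <= enorm (x - x0)].
Let M := fine (sigma K).

Let cK : closed K. Proof. exact: closed_boundary. Qed.

Let r0 : 0 < r. Proof. by rewrite enorm_gt0// subr_eq0 eq_sym. Qed.

Let cfar : closed far.
Proof. by apply: closedI => //; exact: closed_enorm_ge. Qed.

Let KE : sigma K = M%:E.
Proof. by rewrite fineK// ge0_fin_numE// measure_ge0. Qed.

Let M0 : 0 <= M. Proof. by rewrite fine_ge0// measure_ge0. Qed.

Let farE : sigma far = (fine (sigma far))%:E.
Proof.
rewrite fineK// ge0_fin_numE ?measure_ge0//; apply: le_lt_trans Koo.
by apply: le_measure; rewrite ?inE; do ?[exact: closed_sigma_measurable];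
  exact: subIsetl.
Qed.

(** The mean value property of the Poisson kernel with pole [a]. Its value at [x0] is
    [|a - x0| ^ (2 - n)]. On the boundary near [z] the kernel is at most twice the
    flatness integrand. Elsewhere on the boundary it is at most [e], because the
    boundary stays outside the ball of radius [r] while [a] almost lies on its sphere,
    and it is bounded above by a negative constant on [far]. *)
Let pole_estimate (Lam e rho eta : R) a :
  (forall x, K x -> enorm (x - a) <= Lam) -> 0 < Lam -> 0 < e ->
  0 < rho -> rho <= delta -> 0 < eta -> eta <= rho / 2 -> eta <= 1 ->
  eta * (2 * r + 1) <= e * (rho / 2) ^+ n ->
  ~ closure Omega a -> enorm (a - z) < eta ->
  (flatness_integral Omega x0 z rho a < (n%:R * omega n * r / 2 + e)%:E)%E ->
  M / (r + eta) ^+ (n - 2) + delta * r / Lam ^+ n * fine (sigma far) <=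
  n%:R * omega n * r + 2 * e + e * M.
Proof.
move=> KLam Lam0 e0 rho0 rhod eta0 eta_rho eta1 eta_e aO az aF.
have aK x : closure Omega x -> x != a by move=> Ox; apply/eqP => xa; rewrite xa in Ox.
have KO : K `<=` closure Omega by move=> x [].
have ax0 : a != x0.
  by rewrite eq_sym; apply: aK; exact: subset_closure.
have ac : enorm (a - x0) <= r + eta.
  by have := enorm_dist a z x0; rewrite -/r; lra.
have ac0 : 0 < enorm (a - x0) by rewrite enorm_gt0// subr_eq0.
pose p := poisson a x0.
pose f x := dot (a - x) (a - x0) / enorm (x - a) ^+ n.
have [d d0 dK] : exists2 d : R, 0 < d & forall x, K x -> d <= enorm (x - a).
  have [d d0 dO] := open_eball (closed_openC (@closed_closure _ Omega)) aO.
  exists d => // x /KO Ox; rewrite leNgt; apply/negP => xd.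
  by have /dO : eball a d x by [].
have wd x (k : R) : 0 < k -> k <= enorm (x - a) -> 0 <= invpow a n x <= (k ^+ n)^-1.
  move=> k0 kx; rewrite /invpow invr_ge0 exprn_ge0 ?enorm_ge0//=.
  rewrite lef_pV2 ?posrE ?exprn_gt0//; last exact: lt_le_trans kx.
  by rewrite lerXn2r ?nnegrE// ?enorm_ge0// ltW.
have fE x : 2 * f x = dot (x - a) (x - a) * invpow a n x + p x.
  exact: flatness_integrandE.
have w0 x : 0 <= invpow a n x by rewrite invr_ge0 exprn_ge0// enorm_ge0.
have cp x : closure Omega x -> {for x, continuous p}.
  by move=> /aK; exact: continuous_poisson.
have cf x : closure Omega x -> {for x, continuous f}.
  move=> Ox; rewrite (_ : f = (fun y => 2^-1 *
      (dot (y - a) (y - a) * invpow a n y - (0 - p y)))); last first.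
    by apply/funext => y; rewrite sub0r opprK -fE mulKf.
  apply: continuous_mul; first exact: continuous_const.
  apply: continuous_sub; last by apply: continuous_sub; [exact: continuous_const|exact: cp].
  by apply: continuous_mul; [exact: continuous_sqdist|apply: continuous_invpow; exact: aK].
have bnd (g : 'rV[R]_n -> R) (C : R) : (forall x, K x -> `|g x| <= C) ->
    forall C', C <= C' -> forall x, K x -> `|g x| <= C'.
  by move=> gC C' CC' x /gC /le_trans; apply.
pose Cp := (enorm (a - x0) ^+ 2 + (Lam + enorm (a - x0)) ^+ 2) * (d ^+ n)^-1.
have xx0 x : K x -> enorm (x - x0) <= Lam + enorm (a - x0).
  by move=> Kx; have := enorm_dist x a x0; have := KLam x Kx; lra.
have pCp x : K x -> `|p x| <= Cp.
  move=> Kx; rewrite /p /poisson normrM (ger0_norm (w0 x)).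
  have /andP[_ wx] := wd x d d0 (dK x Kx).
  apply: ler_pM => //; rewrite -!sqr_enorm.
  apply: le_trans (ler_normB _ _) _; rewrite !ger0_norm ?sqr_ge0// lerD2l.
  by rewrite lerXn2r ?nnegrE ?enorm_ge0 ?addr_ge0 ?enorm_ge0 ?(ltW Lam0) ?xx0.
have fCp x : K x -> `|f x| <= Lam ^+ 2 * (d ^+ n)^-1 + Cp.
  move=> Kx; apply: (@le_trans _ _ `|2 * f x|).
    by rewrite [leRHS]normrM normr_nat ler_peMl// ler1n.
  rewrite fE; apply: le_trans (ler_normD _ _) _; apply: lerD; last exact: pCp.
  rewrite normrM (ger0_norm (w0 x)) (ger0_norm (dot_ge0 _)) -sqr_enorm.
  have /andP[_ wx] := wd x d d0 (dK x Kx).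
  apply: ler_pM => //; first exact: sqr_ge0.
  by rewrite lerXn2r ?nnegrE ?enorm_ge0 ?KLam ?(ltW Lam0).
have cB : closed (~` eball z rho) by apply: open_closedC; exact: open_eball_set.
have main := @integral_upper_split _ _ R (@sigma R n) K (eball z rho) far p f
  (Lam ^+ 2 * (d ^+ n)^-1 + Cp) e (e + delta * r / Lam ^+ n).
have {}main : (\int[sigma]_(x in K) (p x)%:E +
    (e + delta * r / Lam ^+ n)%:E * sigma far <=
   2%:E * \int[sigma]_(x in K `&` eball z rho) (f x)%:E + e%:E * sigma K)%E.
  apply: main => //.
  - exact: closed_sigma_measurable.
  - by rewrite -[eball z rho]setCK; apply: measurableC; exact: closed_sigma_measurable.
  - exact: closed_sigma_measurable.
  - by apply: continuous_sigma_measurable => // x /KO; exact: cp.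
  - by apply: (bnd _ _ pCp); rewrite lerDr mulr_ge0 ?sqr_ge0// invr_ge0 exprn_ge0// ltW.
  - by apply: continuous_sigma_measurable => // x /KO; exact: cf.
  - by move=> x [].
  - move=> x [Kx farx] zx; have {}zx : enorm (x - z) < rho by [].
    by have := enorm_dist x z x0; move: farx => /=; rewrite -/r; lra.
  - move=> x Kx _; rewrite fE -addrA addrCA lerDl addr_ge0 ?(ltW e0)//.
    by rewrite mulr_ge0// dot_ge0.
  - move=> x Kx /negP; rewrite -leNgt => zx.
    have rx : rho / 2 <= enorm (x - a).
      by have := enorm_dist x a z; lra.
    have /andP[_ wx] := wd x _ (divr_gt0 rho0 (ltr0Sn R 1)) rx.
    rewrite /p /poisson -!sqr_enorm.
    apply: (@le_trans _ _ (eta * (2 * r + 1) * invpow a n x)).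
      apply: ler_wpM2r => //; have := Kr Kx; have := enorm_ge0 (a - x0); rewrite -/r.
      move: (enorm (a - x0)) (enorm (x - x0)) ac r0 => u v ac r0' u0 rv.
      by nra.
    apply: (@le_trans _ _ (eta * (2 * r + 1) * ((rho / 2) ^+ n)^-1)).
      by apply: ler_wpM2l wx; rewrite mulr_ge0 ?addr_ge0 ?mulr_ge0// ltW.
    by rewrite ler_pdivrMr// exprn_gt0// divr_gt0.
  - move=> x [Kx /= farx]; rewrite opprD addNKr.
    have xL := KLam x Kx.
    have xa0 := lt_le_trans d0 (dK x Kx).
    rewrite /p /poisson -!sqr_enorm.
    apply: (@le_trans _ _ (- (delta * r) * invpow a n x)).
      apply: ler_wpM2r => //; have := enorm_ge0 (a - x0).
      move: (enorm (a - x0)) (enorm (x - x0)) ac r0 farx => u v ac r0' farx u0.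
      by nra.
    rewrite mulNr lerN2; apply: ler_wpM2l; first by rewrite mulr_ge0// ltW.
    rewrite lef_pV2 ?posrE ?exprn_gt0//.
    by rewrite lerXn2r ?nnegrE// ?enorm_ge0// ltW.
have px0 : p x0 = (enorm (a - x0) ^+ (n - 2))^-1 by exact: poisson_center.
have MVP : M * p x0 = fine (\int[sigma]_(x in K) (p x)%:E)%E.
  have pH : harmonic_on Omega p.
    by apply: poisson_harmonic => Oa; apply: aO; exact: subset_closure.
  have pC : {within closure Omega, continuous p}.
    by apply: continuous_in_subspaceT => x /set_mem; exact: cp.
  have := pO pH pC; rewrite /boundary_mean -/K -/M => E.
  have M1 : M != 0.
    apply/eqP => M1; move: E; rewrite M1 invr0 mul0r px0 => /eqP; apply/negP.
    by rewrite invr_eq0 expf_neq0// gt_eqF.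
  by rewrite E mulrA mulfV// mul1r.
have intp : (\int[sigma]_(x in K) (p x)%:E = (M * p x0)%:E)%E.
  rewrite MVP fineK//.
  apply: integrable_fin_num; first exact: closed_sigma_measurable.
  apply: measurable_bounded_integrable => //; first exact: closed_sigma_measurable.
    by apply: continuous_sigma_measurable => // x /KO; exact: cp.
  exact: (@bounded_on _ (caratheodory_type (@hausdorff R n n.-1)) R K p Cp pCp).
move: main; rewrite intp farE KE => main.
have le2 : (2%:E * \int[sigma]_(x in K `&` eball z rho) (f x)%:E <=
    2%:E * (n%:R * omega n * r / 2 + e)%:E)%E by apply: lee_wpmul2l => //; exact: ltW.
have {main le2} := le_trans main (leeD2r _ le2).
rewrite -!EFinM -!EFinD lee_fin px0 => main.
have sfar : 0 <= fine (sigma far) by rewrite fine_ge0// measure_ge0.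
have le3 : M / (r + eta) ^+ (n - 2) <= M / enorm (a - x0) ^+ (n - 2).
  apply: ler_wpM2l => //; rewrite lef_pV2 ?posrE ?exprn_gt0 ?addr_gt0//.
  by rewrite lerXn2r ?nnegrE ?enorm_ge0// addr_ge0 ?enorm_ge0// ltW.
have le4 : 0 <= e * fine (sigma far) by rewrite mulr_ge0// ltW.
by move: main; rewrite mulrDl mulrDr [2 * (_ / 2)]mulrC divfK// => main; lra.
Qed.


(** The previous estimate with [a] tending to [z]; the constant [kap] does
    not depend on [a]. *)
Lemma pseudosphere_bound : exists2 kap : R, 0 < kap &
  M / r ^+ (n - 2) + kap * fine (sigma far) <= n%:R * omega n * r.
Proof.
have [L L0 KL] := bounded_enorm x0 bO.
pose Lam := L + r + 1; have Lam0 : 0 < Lam by rewrite !addr_gt0.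
exists (delta * r / Lam ^+ n); first by rewrite divr_gt0 ?mulr_gt0// exprn_gt0.
set kap := delta * r / Lam ^+ n.
rewrite addrC -lerBrDr -lee_fin.
rewrite (_ : n%:R * omega n * r - M / r ^+ (n - 2) =
   n%:R * omega n * r + 2 * 0 + 0 * M - M * ((r + 0) ^+ (n - 2))^-1); last first.
  by rewrite mulr0 mul0r !addr0.
apply: (@lee_right_continuous _ (fun e => n%:R * omega n * r + 2 * e + e * M -
    M * ((r + e) ^+ (n - 2))^-1)).
  have cid : {for (0 : R), continuous (fun e : R => e)} by exact: cvg_id.
  have cc (k : R) : {for (0 : R), continuous (fun e : R => k)} by exact: cvg_cst.
  have c1 : {for (0 : R), continuous (fun e : R => n%:R * omega n * r + 2 * e + e * M)}.
    apply: (@continuousD _ R^o); last by apply: continuousM.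
    by apply: (@continuousD _ R^o) => //; apply: continuousM.
  have c2 : {for (0 : R), continuous (fun e : R => (r + e) ^+ (n - 2))}.
    apply: (@continuous_comp _ _ _ (fun e : R => r + e) (fun u => u ^+ (n - 2))).
      exact: (@continuousD _ R^o).
    exact: exprn_continuous.
  have c3 : {for (0 : R), continuous (fun e : R => M * ((r + e) ^+ (n - 2))^-1)}.
    apply: continuousM => //.
    apply: (@continuousV _ _ (fun e : R => (r + e) ^+ (n - 2))) => //.
    by rewrite addr0 expf_neq0// gt_eqF.
  exact: (@continuousB _ R^o).
move=> e e0; rewrite lee_fin.
have nO0 : (0 < n)%N by exact: ltnW.
have [rho /andP[rho0 rhod] approx] := flatness_le1_approx nO0 x0z S1 e0 delta0.
have r20 : 0 < 2 * r + 1 by rewrite addr_gt0// mulr_gt0.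
have q0 : 0 < e * (rho / 2) ^+ n / (2 * r + 1).
  by rewrite divr_gt0// mulr_gt0// exprn_gt0// divr_gt0.
pose eta := Num.min (Num.min (rho / 2) 1) (Num.min e (e * (rho / 2) ^+ n / (2 * r + 1))).
have eta0 : 0 < eta by rewrite !lt_min q0 e0 ltr01 divr_gt0.
have etae : eta <= e by rewrite !ge_min lexx !orbT.
have [a [aO az aF]] := approx eta eta0.
have eta1 : eta <= 1 by rewrite !ge_min lexx !orbT.
have est : M / (r + eta) ^+ (n - 2) + kap * fine (sigma far) <=
    n%:R * omega n * r + 2 * e + e * M.
  apply: (pole_estimate (rho := rho) (a := a)) => //.
  - move=> x [/KL xL _].
    have := enorm_dist x x0 a; have := enorm_dist x0 z a.
    by rewrite (enormB x0 z) (enormB z a) -/r /Lam; lra.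
  - exact: ltW.
  - by rewrite !ge_min lexx.
  - by rewrite -ler_pdivlMr// !ge_min lexx !orbT.
have : M / (r + e) ^+ (n - 2) <= M / (r + eta) ^+ (n - 2).
  apply: ler_wpM2l => //; rewrite lef_pV2 ?posrE ?exprn_gt0 ?addr_gt0//.
  by rewrite lerXn2r ?nnegrE ?lerD2l// addr_ge0// ltW.
by move: est; lra.
Qed.

End Estimate.

End PseudosphereEstimate.

(** * Rays meet the boundary *)

Section Crossing.
Context {R : realType} {n : nat}.
Implicit Types (Omega : set 'rV[R]_n) (p q x y : 'rV[R]_n).

Lemma nbhs_eball_sub x (B : set 'rV[R]_n) : nbhs x B ->
  exists2 e : R, 0 < e & eball x e `<=` B.
Proof.
move=> /nbhs_interior xB.
have [e e0 eB] := open_eball (@open_interior _ B) (nbhs_singleton xB).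
by exists e => //; apply: subset_trans eB (@interior_subset _ B).
Qed.

(** The supremum of the times up to which the segment stays in [Omega] is the time of
    first exit. *)
Lemma segment_meets_boundary Omega p q : open Omega -> Omega p -> ~ Omega q ->
  exists2 s : R, 0 < s <= 1 & boundary Omega (p + s *: (q - p)).
Proof.
move=> oO Op Oq; pose g (s : R) := p + s *: (q - p).
have gB s t : enorm (g s - g t) = `|s - t| * enorm (q - p).
  by rewrite -enormZ; congr enorm; apply/rowP => i; rewrite !mxE; ring.
pose S := [set t : R | 0 <= t <= 1 /\ forall s, 0 <= s <= t -> Omega (g s)].
have g0 : g 0 = p by rewrite /g scale0r addr0.
have g1 : g 1 = q by rewrite /g scale1r subrKC.
have S0 : S 0.
  by split; [rewrite lexx ler01|move=> s s0; rewrite (@le_anti _ _ s 0) ?g0 // andbC].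
have hS : has_sup S.
  by split; [exists 0|exists 1 => t [/andP[]]].
pose t := sup S.
have t0 : 0 <= t by apply: ub_le_sup S0; exact: hS.2.
have t1 : t <= 1 by apply: ge_sup; [exact: hS.1|move=> u [/andP[]]].
have k0 : 0 < enorm (q - p) + 1 by rewrite ltr_wpDl ?enorm_ge0.
have near e : 0 < e ->
    exists2 d : R, 0 < d & forall s, `|s - t| < d -> eball (g t) e (g s).
  move=> e0; exists (e / (enorm (q - p) + 1)); first by rewrite divr_gt0.
  move=> s; rewrite ltr_pdivlMr// /eball/= gB => /(le_lt_trans _); apply.
  by apply: ler_wpM2l => //; rewrite lerDl.
have Ot : ~ Omega (g t).
  move=> Ot; have [e e0 eO] := open_eball oO Ot.
  have [d d0 dO] := near e e0.
  have [u Su tu] := sup_adherent d0 hS; have [/andP[u0 u1] uO] := Su.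
  have gtO s : 0 <= s -> s < t + d -> Omega (g s).
    move=> s0 sd; have [su|us] := leP s u; first by apply: uO; rewrite s0.
    by apply/eO/dO; rewrite ltr_norml; apply/andP; split; move: tu; rewrite -/t; lra.
  have [td|td] := ltP (t + d / 2) 1; last first.
    by apply: Oq; rewrite -g1; apply: gtO => //; lra.
  have : S (t + d / 2).
    split; first by apply/andP; split; lra.
    by move=> s /andP[s0 sd]; apply: gtO => //; lra.
  by move=> /(ub_le_sup hS.2); rewrite -/t; lra.
exists t.
  rewrite t1 andbT lt_neqAle t0 andbT; apply/eqP => t00.
  by apply: Ot; rewrite -t00 g0.
split; last by move=> /interior_subset.
move=> B /nbhs_eball_sub[e e0 eB]; have [d d0 dO] := near e e0.
have [u Su tu] := sup_adherent d0 hS; have [/andP[u0 u1] uO] := Su.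
exists (g u); split; first by apply: uO; rewrite u0 lexx.
apply/eB/dO; have := ub_le_sup hS.2 Su; rewrite -/t ltr_norml => ut.
by apply/andP; split; move: tu; rewrite -/t; lra.
Qed.

(** A bounded set contains no ray, so [segment_meets_boundary] applies to a long enough
    segment. *)
Lemma ray_meets_boundary Omega y v : open Omega -> bounded_set Omega -> v != 0 ->
  Omega y -> exists2 s : R, 0 < s & boundary Omega (y + s *: v).
Proof.
move=> oO bO v0 Oy; have [L L0 OL] := bounded_enorm y bO.
have vp := enorm_gt0 v0; pose k := (L + 1) / enorm v.
have k0 : 0 < k by rewrite divr_gt0// addr_gt0.
have Oq : ~ Omega (y + k *: v).
  move=> /subset_closure/OL.
  rewrite addrAC subrr add0r enormZ gtr0_norm// divfK ?gt_eqF//.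
  by rewrite leNgt ltrDl ltr01.
have [s /andP[s0 _] sB] := segment_meets_boundary oO Oy Oq.
exists (s * k); first exact: mulr_gt0.
by move: sB; rewrite addrAC subrr add0r scalerA.
Qed.

End Crossing.

(** * Rigidity *)

Theorem corollary1p9 (R : realType) (n : nat) (Omega : set 'rV[R]_n)
    (x0 z : 'rV[R]_n) :
  (2 <= n)%N ->
  open Omega ->
  bounded_set Omega ->
  (sigma (boundary Omega) < +oo)%E ->
  Omega x0 ->
  harmonic_pseudosphere Omega x0 ->
  touching_set Omega x0 z ->
  (spherical_flatness Omega x0 z <= 1)%E ->
  boundary Omega = boundary (eball x0 (enorm (x0 - z))).
Proof.
case: n Omega x0 z => [//|m] Omega x0 z n1 oO bO Koo Ox0 pO [Kz zr] S1.
pose K := boundary Omega.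
have KO x : K x -> ~ Omega x.
  by move=> [_ nO] Ox; apply: nO; rewrite (interior_id _).1.
have x0z : x0 != z by apply/eqP => E; apply: (KO z) => //; rewrite -E.
have Kr x : K x -> enorm (z - x0) <= enorm (x - x0).
  move=> Kx; rewrite enormB zr (enormB x); apply: ge_inf; last by exists x.
  by exists 0 => _ [y _ <-]; exact: enorm_ge0.
rewrite enormB; set r := enorm (z - x0).
have r0 : 0 < r by rewrite enorm_gt0// subr_eq0 eq_sym.
suff -> : Omega = eball x0 r by [].
have ballO : eball x0 r `<=` Omega.
  move=> y yr; apply: contrapT => Oy.
  have [s /andP[s0 s1] /Kr] := segment_meets_boundary oO Ox0 Oy.
  rewrite addrAC subrr add0r enormZ gtr0_norm// leNgt => /negP; apply.
  apply: le_lt_trans yr; rewrite ler_piMl ?enorm_ge0//.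
apply/seteqP; split=> // y Oy; apply: contrapT => /negP; rewrite -leNgt => ry.
(* Moving away from [x0] inside the open set gives a point strictly outside the ball. *)
have [w [Ow rw]] : exists w, Omega w /\ r < enorm (w - x0).
  have [e e0 eO] := open_eball oO Oy.
  have yp : 0 < enorm (y - x0) by exact: lt_le_trans ry.
  pose t := e / (2 * enorm (y - x0)); have t0 : 0 < t by rewrite divr_gt0 ?mulr_gt0.
  exists (y + t *: (y - x0)); split.
    apply: eO; rewrite /eball/= addrAC subrr add0r enormZ gtr0_norm//.
    rewrite (_ : t * _ = e / 2); last by rewrite /t; field; rewrite gt_eqF.
    by rewrite ltr_pdivrMr// ltr_pMr// ltr1n.
  rewrite (_ : _ - x0 = (1 + t) *: (y - x0)); last first.
    by rewrite scalerDl scale1r addrAC.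
  rewrite enormZ gtr0_norm ?addr_gt0// mulrDl mul1r.
  by apply: le_lt_trans ry _; rewrite ltrDl mulr_gt0.
(* All the rays from [x0] through points near [w] meet the boundary beyond them, hence
   at distance at least [r + delta] from [x0]. *)
pose delta := (enorm (w - x0) - r) / 2.
have delta0 : 0 < delta by rewrite divr_gt0// subr_gt0.
have [kap kap0 bound] :=
  pseudosphere_bound n1 oO bO Koo Ox0 pO x0z Kr S1 delta0.
pose far := K `&` [set x | r + delta <= enorm (x - x0)].
have area : m.+1%:R * omega m.+1 * r ^+ m <= fine (sigma K).
  rewrite -lee_fin fineK ?ge0_fin_numE ?measure_ge0//.
  apply: (@hausdorff_ge_sphere R m K x0 r) => // v v0.
  have [s s0 Ks] := ray_meets_boundary oO bO v0 Ox0.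
  exists (x0 + s *: v), s^-1; split=> //; first by rewrite invr_gt0.
  by rewrite addrAC subrr add0r scalerA mulVf ?scale1r// gt_eqF.
have far0 : (0 < sigma far)%E.
  have [e e0 eO] := open_eball oO Ow.
  have w0 : w - x0 != 0.
    by apply: contraTneq rw => ->; rewrite enorm0 -leNgt; exact: ltW.
  apply: (@hausdorff_gt0 R m far x0 (w - x0) r (Num.min e delta)) => //.
  - by rewrite lt_min e0.
  - by move=> a [/Kr].
  move=> v vw; have {}vw : enorm (v - (w - x0)) < Num.min e delta by [].
  move: vw; rewrite lt_min => /andP[vwe vwd].
  have vr : r + delta <= enorm v.
    have := enormD ((w - x0) - v) v; rewrite subrK (enormB (w - x0) v).
    by move: vwd; rewrite /delta; lra.
  have v0 : v != 0.
    by apply: contraTneq vr => ->; rewrite enorm0 -ltNge addr_gt0.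
  have Ov : Omega (x0 + v).
    apply: eO; rewrite /eball/= (_ : x0 + v - w = v - (w - x0))//.
    by rewrite opprB addrA (addrC x0).
  have [s s0 Ks] := ray_meets_boundary oO bO v0 Ov.
  have E : x0 + v + s *: v - x0 = (1 + s) *: v.
    by apply/rowP => i; rewrite !mxE; ring.
  exists (x0 + v + s *: v), (1 + s)^-1; split.
  - split=> //=; rewrite E enormZ gtr0_norm ?addr_gt0// mulrDl mul1r.
    by apply: le_trans vr _; rewrite lerDl mulr_ge0 ?enorm_ge0// ltW.
  - by rewrite invr_gt0 addr_gt0.
  - by rewrite E scalerA mulVf ?scale1r// gt_eqF// addr_gt0.
have far0' : 0 < fine (sigma far).
  rewrite -lte_fin fineK// ge0_fin_numE ?measure_ge0//; apply: le_lt_trans Koo.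
  by apply: (@le_outer_measure _ _ (@hausdorff R m.+1 m)); exact: subIsetl.
have : m.+1%:R * omega m.+1 * r <= fine (sigma K) / r ^+ (m.+1 - 2).
  rewrite ler_pdivlMr ?exprn_gt0// -[_ * r * _]mulrA -exprS.
  by rewrite (_ : (m.+1 - 2).+1 = m)//; lia.
have := mulr_gt0 kap0 far0'; move: bound; rewrite -/K -/r -/far; lra.
Qed.
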